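(* Let $M$ be a $(2n+k)$-dimensional locally $k$-standard $T$-manifold whose orbit space is an $n$-dimensional simple polytope $P$, with hyper characteristic function $\lambda:\mathcal{F}(P)\to\mathbb{Z}^{n+k}$. If $\operatorname{rk}(\lambda)=n+k$, then the fundamental group $\pi_1(M)$ is a finite abelian group.
   Context: The $k$-standard action of $T^{n+k}$ on $\mathbb{C}^n\times T^k\subset\mathbb{C}^{n+k}$ is coordinatewise multiplication. A locally $k$-standard $T$-manifold is a smooth $(2n+k)$-dimensional manifold $M$ with an effective $T^{n+k}$-action such that each point $p$ has a $T^{n+k}$-invariant neighborhood which, for some $\theta_p\in\operatorname{Aut}(T^{n+k})$, is $\theta_p$-equivariantly diffeomorphic to a $T^{n+k}$-invariant subset of $\mathbb{C}^n\times T^k$. When $M/T^{n+k}$ is a simple polytope $P$ (as a manifold with corners) with orbit map $\mathfrak{q}:M\to P$ and facets $\mathcal{F}(P)=\{F_1,\dots,F_m\}$, the isotropy subgroup of $M_i=\mathfrak{q}^{-1}(F_i)$ is a circle subgroup of $T^{n+k}$, determined by a primitive vector $\lambda_i\in\mathbb{Z}^{n+k}\cong\operatorname{Hom}(S^1,T^{n+k})$ (unique up to sign); set $\lambda(F_i)=\lambda_i$. $\operatorname{rk}(\lambda)$ is the rank of the submodule of $\mathbb{Z}^{n+k}$ generated by $\lambda_1,\dots,\lambda_m$. $M$ is equivariantly homeomorphic to $(T^{n+k}\times P)/_\sim$, where $(t,p)\sim(s,q)$ iff $p=q$ and $t^{-1}s$ lies in the subtorus generated by the circles determined by those $\lambda_j$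 with $p\in F_j$. *)

(* Defs.v *)
From HB Require Import structures.
From mathcomp Require Import all_boot all_order all_algebra.
From mathcomp Require Import complex.
From mathcomp Require Import all_classical all_reals all_analysis.

Set Implicit Arguments.
Unset Strict Implicit.
Unset Printing Implicit Defensive.

Import Order.TTheory GRing.Theory Num.Theory.
Import numFieldNormedType.Exports.

Local Open Scope classical_set_scope.
Local Open Scope ring_scope.

Section Smooth.
Variables (R : realType) (E F : normedModType R).

(* On a finite-dimensional E and an open U this is the usual class C^r: all
   directional derivatives of order at most r exist and are continuous. *)
Fixpoint Cr_on (r : nat) (U : set E) (f : E -> F) : Prop :=
  (forall x, U x -> {for x, continuous f}) /\
  if r is r'.+1 then
    (forall x v, U x -> derivable f x v) /\
    (forall v, Cr_on r' U ('D_v f))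
  else True.

(* Smoothness on an arbitrary subset X: local extendability to a C^oo function
   on an open set of E. For X open this is smoothness in the usual sense. *)
Definition smooth_on (X : set E) (f : E -> F) : Prop :=
  forall x, X x -> exists W : set E, exists g : E -> F,
    [/\ open W, W x, forall r, Cr_on r W g &
        forall y, X y -> W y -> f y = g y].

End Smooth.

Section Manifold.
Variables (R : realType) (M : topologicalType) (d : nat).

(* [cinv] is only meaningful on the image of [cdom] under [cmap]. *)
Record chart := Chart {
  cdom : set M;
  cmap : M -> 'rV[R]_d;
  cinv : 'rV[R]_d -> M }.

Definition is_chart (c : chart) : Prop :=
  [/\ open (cdom c), open (cmap c @` cdom c),
      {within cdom c, continuous (cmap c)},
      {within cmap c @` cdom c, continuous (cinv c)} &
      forall x, cdom c x -> cinv c (cmap c x) = x].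

Definition smooth_atlas (A : set chart) : Prop :=
  [/\ forall c, A c -> is_chart c,
      forall x, exists2 c, A c & cdom c x &
      forall c c', A c -> A c' ->
        smooth_on (cmap c @` (cdom c `&` cdom c')) (cmap c' \o cinv c)].

Definition smooth_manifold (A : set chart) : Prop :=
  [/\ hausdorff_space M, @second_countable M & smooth_atlas A].

End Manifold.

(* C^N as a real normed space: real parts and imaginary parts. *)
Notation cspace R N := ('rV[R]_N * 'rV[R]_N)%type.

Section Torus.
Variables (R : realType) (N : nat).

Definition ccoord (z : cspace R N) (j : 'I_N) : R[i] :=
  Complex (z.1 0 j) (z.2 0 j).

Definition of_coord (w : 'I_N -> R[i]) : cspace R N :=
  (\row_j complex.Re (w j), \row_j complex.Im (w j)).

Definition cmul (z w : cspace R N) : cspace R N :=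
  of_coord (fun j => ccoord z j * ccoord w j).

Definition cone : cspace R N := of_coord (fun=> 1).

Definition torus : set (cspace R N) := [set t | forall j, `|ccoord t j| = 1].

(* A continuous bijective endomorphism of the compact Lie group T^N is an
   automorphism of Lie groups. *)
Definition torus_aut (theta : cspace R N -> cspace R N) : Prop :=
  [/\ set_bij torus torus theta,
      {within torus, continuous theta} &
      forall t s, torus t -> torus s ->
        theta (cmul t s) = cmul (theta t) (theta s)].

(* The one-parameter subgroup S^1 -> T^N, z |-> (z^v_1, .., z^v_N). *)
Definition cochar (v : 'rV[int]_N) (z : R[i]) : cspace R N :=
  of_coord (fun j => z ^ (v 0 j)).

Definition circle_of (v : 'rV[int]_N) : set (cspace R N) :=
  [set cochar v z | z in [set z : R[i] | `|z| = 1]].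

End Torus.

Section Action.
Variables (R : realType) (M : topologicalType) (d N : nat).
Variable A : set (chart R M d).

(* The action is a map on all of C^N x M, of which only the restriction to
   T^N x M is meaningful. *)
Variable act : cspace R N -> M -> M.

Definition smooth_torus_action : Prop :=
  [/\ forall x, act (cone R N) x = x,
      forall t s x, torus t -> torus s -> act (cmul t s) x = act t (act s x),
      {within (@torus R N) `*` setT,
        continuous (fun p : cspace R N * M => act p.1 p.2)} &
      forall c c', A c -> A c' ->
        smooth_on
          [set p : cspace R N * 'rV[R]_d | [/\ torus p.1,
             (cmap c @` cdom c) p.2 & cdom c' (act p.1 (cinv c p.2))]]
          (fun p => cmap c' (act p.1 (cinv c p.2)))].

Definition effective : Prop :=
  forall t, torus t -> (forall x, act t x = x) -> t = cone R N.

End Action.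

Section Standard.
Variables (R : realType) (n k : nat) (M : topologicalType) (d : nat).

Local Notation C := (cspace R (n + k)).

(* C^n x T^k as a subset of C^(n+k) *)
Definition std_space : set C := [set z | forall j, `|ccoord z (rshift n j)| = 1].

Variables (A : set (chart R M d)) (act : C -> M -> M).

Record std_chart := StdChart {
  sdom : set M;
  smap : M -> C;
  sinv : C -> M;
  saut : C -> C }.

Definition simg (s : std_chart) : set C := smap s @` sdom s.

(* [smap s] is a diffeomorphism from an invariant open subset of M onto an
   invariant (relatively open) subset of C^n x T^k, equivariant up to the
   automorphism [saut s] of the torus. *)
Definition is_std_chart (s : std_chart) : Prop :=
  [/\ open (sdom s)
        /\ (forall t x, torus t -> sdom s x -> sdom s (act t x)),
      simg s `<=` std_space
        /\ (exists2 W : set C, open W & simg s = W `&` std_space)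
        /\ (forall t z, torus t -> simg s z -> simg s (cmul t z)),
      (forall x, sdom s x -> sinv s (smap s x) = x)
        /\ {within sdom s, continuous (smap s)}
        /\ {within simg s, continuous (sinv s)},
      (forall c, A c ->
        smooth_on (cmap c @` (cdom c `&` sdom s)) (smap s \o cinv c)
        /\ smooth_on (simg s `&` sinv s @^-1` cdom c) (cmap c \o sinv s)) &
      torus_aut (saut s) /\
      (forall t x, torus t -> sdom s x ->
        smap s (act t x) = cmul (saut s t) (smap s x))].

Definition locally_standard : Prop :=
  forall p : M, exists2 s, is_std_chart s & sdom s p.

End Standard.

Definition locally_k_standard_T_manifold (R : realType) (n k : nat)
    (M : topologicalType) (A : set (chart R M (2 * n + k)))
    (act : cspace R (n + k) -> M -> M) : Prop :=
  [/\ smooth_manifold A, smooth_torus_action A act, effective act &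
      locally_standard A act].

Section Polytope.
Variables (R : realType) (n m : nat) (a : 'I_m -> 'rV[R]_n) (b : 'I_m -> R).

Definition dotp (u v : 'rV[R]_n) : R := \sum_j u 0 j * v 0 j.

Definition polytope : set 'rV[R]_n := [set x | forall i, dotp (a i) x <= b i].

Definition facet (i : 'I_m) : set 'rV[R]_n :=
  polytope `&` [set x | dotp (a i) x = b i].

Definition facets_at (x : 'rV[R]_n) : {set 'I_m} := [set i | `[< facet i x >]].

Definition vertex (v : 'rV[R]_n) : Prop :=
  polytope v /\
  forall x y, polytope x -> polytope y -> v = 2^-1 *: (x + y) -> x = y.

(* The third clause says that the presentation by inequalities is irredundant,
   so that the facets of the polytope are exactly the sets [facet i], without
   repetition. *)
Definition simple_polytope : Prop :=
  [/\ bounded_set polytope, polytope° !=set0,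
      forall i, exists x, facets_at x = [set i]%SET &
      forall v, vertex v -> #|facets_at v| = n].

End Polytope.

Section OrbitSpace.
Variables (R : realType) (n k m : nat) (M : topologicalType) (d : nat).
Variables (A : set (chart R M d)) (act : cspace R (n + k) -> M -> M).
Variables (a : 'I_m -> 'rV[R]_n) (b : 'I_m -> R) (q : M -> 'rV[R]_n).

(* [q] induces a homeomorphism from M / T^(n+k) to the polytope: it is a
   continuous surjection onto it, whose fibers are the orbits, and a quotient
   map. *)
Definition orbit_map : Prop :=
  [/\ continuous q, range q = polytope a b,
      forall x y, q x = q y <-> exists2 t, torus t & y = act t x &
      forall V : set 'rV[R]_n, open (q @^-1` V) ->
        exists2 W : set 'rV[R]_n, open W &
          V `&` polytope a b = W `&` polytope a b].

(* A standard chart induces a chart (|z_1|, .., |z_n|) of M / T^(n+k) with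
   values in the orthant [0, +oo[^n; the homeomorphism induced by [q] is one of
   manifolds with corners when a point where j of these coordinates vanish is
   mapped to the relative interior of a face of codimension j. *)
Definition preserves_corners : Prop :=
  forall s x, is_std_chart A act s -> sdom s x ->
    #|[set j : 'I_n | ccoord (smap s x) (lshift k j) == 0]%SET|
      = #|facets_at a b (q x)|.

Definition primitive_vector (N : nat) (v : 'rV[int]_N) : Prop :=
  forall c : int, (forall j, (c %| v ord0 j)%Z) -> `|c|%N = 1%N.

Definition hyper_characteristic (lam : 'I_m -> 'rV[int]_(n + k)) : Prop :=
  forall i, primitive_vector (lam i) /\
    [set t : cspace R (n + k) |
       torus t /\ forall x, facet a b i (q x) -> act t x = x]
      = circle_of (lam i).

End OrbitSpace.

(* The rank of the submodule of Z^N generated by the [lam i]. *)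
Definition rk (N m : nat) (lam : 'I_m -> 'rV[int]_N) : nat :=
  \rank (\matrix_(i < m, j < N) ((lam i 0 j)%:~R : rat)).

Section FundamentalGroup.
Variables (R : realType) (M : topologicalType) (x0 : M).

Local Notation I := (`[0, 1]%classic : set R).

(* Only the restriction of f to [0, 1] matters. *)
Definition is_loop (f : R -> M) : Prop :=
  [/\ {within I, continuous f}, f 0 = x0 & f 1 = x0].

Definition loop_homotopic (f g : R -> M) : Prop :=
  exists H : R * R -> M,
    [/\ {within I `*` I, continuous H},
        forall t, I t -> H (t, 0) = f t /\ H (t, 1) = g t &
        forall s, I s -> H (0, s) = x0 /\ H (1, s) = x0].

Definition loop_class (f : R -> M) : set (R -> M) :=
  [set g | is_loop g /\ loop_homotopic f g].

Definition loop_concat (f g : R -> M) : R -> M :=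
  fun t => if t <= 2^-1 then f (2 * t) else g (2 * t - 1).

Definition pi1 : set (set (R -> M)) := [set loop_class f | f in is_loop].

Definition pi1_one : set (R -> M) := loop_class (cst x0).

Definition pi1_mul (u v : set (R -> M)) : set (R -> M) :=
  [set h | exists f g, [/\ u f, v g & loop_class (loop_concat f g) h]].

End FundamentalGroup.

Arguments pi1 R {M} x0.
Arguments pi1_one R {M} x0.

Definition finite_abelian_group (T : Type) (G : set T) (op : T -> T -> T)
    (e : T) : Prop :=
  [/\ (forall x y, G x -> G y -> G (op x y))
        /\ (forall x y z, G x -> G y -> G z -> op x (op y z) = op (op x y) z),
      G e /\ (forall x, G x -> op e x = x /\ op x e = x),
      forall x, G x -> exists y, [/\ G y, op y x = e & op x y = e],
      forall x y, G x -> G y -> op x y = op y x &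
      finite_set G].

(* Main.v *)
From Corelib Require Setoid Morphisms.
Require Import Defs.
From mathcomp Require Import all_boot all_order all_algebra.
From mathcomp Require Import complex lra ring.
From mathcomp Require Import all_classical all_reals all_analysis.

Set Implicit Arguments.
Unset Strict Implicit.
Unset Printing Implicit Defensive.

Import Order.TTheory GRing.Theory Num.Theory.
Import numFieldNormedType.Exports.

Local Open Scope classical_set_scope.
Local Open Scope ring_scope.

(** The torus acts on every fundamental group of M through its orbits: an
    integer vector v gives at each point x the orbit loop
    t |-> exp(2 pi i t v) x. These loops form the image of a homomorphism from
    Z^(n+k), and sliding x along a path f shows that orbit loops commute with f
    (orbit_loop_natural). The proof computes pi_1(M) as a quotient of
    Z^(n+k) / (lambda_1, .., lambda_m), in two steps.

    Every loop is homotopic to an orbit loop. This is the surjective half of the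
    theorem of Seifert and van Kampen, over the contractible base P. Call a part
    K of M orbit generated when two paths inside K with the same ends differ, up
    to homotopy in M, by an orbit loop only. In a standard chart, two paths near
    an orbit can be compared coordinate by coordinate
    (chart_nbhs_orbit_generated): where the coordinate stays away from 0, the
    quotient of the phases is a loop of rotations, which is lifted to the
    universal cover of the torus; in a small disc around 0 there is nothing to
    correct. Two overlapping open orbit generated sets whose intersection is path
    connected have an orbit generated union (orbit_generated_union). Small boxes
    of the base lie in charts, large boxes are unions of overlapping smaller
    ones, and preimages of convex open sets are path connected since the fibers
    of M -> P are orbits; so the whole of M is orbit generated
    (orbit_generated_boxes).

    The loop along lambda_i is constant at a point above the facet F_i, because
    the circle of lambda_i fixes that point. By naturality it is then null
    homotopic at every point. When lambda_1, .., lambda_m have rank n + k, the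
    lattice they generate contains D Z^(n+k) for some D > 0, so pi_1(M) is a
    quotient of (Z/D)^(n+k): finite and abelian
    (finite_abelian_of_orbit_loops). *)

(** * Continuous maps and reparametrizations of the unit interval *)

Section Continuity.
Variable R : realType.
Implicit Types (T U V : topologicalType).

Lemma continuous_glue T U (f g : T -> U) (h : T -> R) (c : R) :
  continuous f -> continuous g -> continuous h ->
  (forall x, h x = c -> f x = g x) ->
  continuous (fun x => if h x <= c then f x else g x).
Proof.
move=> cf cg ch fg x B /=.
rewrite nbhs_simpl /=; case: ltgtP => [hx Bf|hx Bg|hx Bf].
- near=> y; rewrite /= ifT.
    by near: y; exact: cf.
  by apply: ltW; near: y; exact: (cvgr_lt _ (ch x)).
- near=> y; rewrite /= ifF.
    by near: y; exact: cg.
  by apply/negbTE; rewrite -ltNge; near: y; exact: (cvgr_gt _ (ch x)).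
- have Bg : nbhs (g x) B by rewrite -fg.
  near=> y => /=; case: ifP => _.
    by near: y; exact: cf.
  by near: y; exact: cg.
Unshelve. all: by end_near. Qed.

Lemma within_continuous_comp T U V (D : set U) (G : U -> V) (f : T -> U) :
  {within D, continuous G} -> continuous f -> (forall t, D (f t)) ->
  continuous (G \o f).
Proof.
move=> /subspace_continuousP cG cf Df t B BG.
have := cf t _ (cG _ (Df t) B BG).
by rewrite !nbhs_simpl /=; apply: filterS => x /=; apply; exact: Df.
Qed.

Lemma continuous_compf T U V (f : T -> U) (g : U -> V) :
  continuous f -> continuous g -> continuous (fun t => g (f t)).
Proof. by move=> cf cg t; apply: continuous_comp; [exact: cf|exact: cg]. Qed.

Lemma continuous_pair T U V (f : T -> U) (g : T -> V) :
  continuous f -> continuous g -> continuous (fun t => (f t, g t)).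
Proof. by move=> cf cg t; apply: cvg_pair; [exact: cf|exact: cg]. Qed.

Lemma continuous_fst T U : continuous (@fst T U).
Proof. by move=> x; exact: cvg_fst. Qed.

Lemma continuous_snd T U : continuous (@snd T U).
Proof. by move=> x; exact: cvg_snd. Qed.

Lemma continuous_maxr T (f g : T -> R) :
  continuous f -> continuous g -> continuous (fun t => Num.max (f t) (g t)).
Proof. by move=> cf cg t; apply: continuous_max; [exact: cf|exact: cg]. Qed.

Lemma continuous_minr T (f g : T -> R) :
  continuous f -> continuous g -> continuous (fun t => Num.min (f t) (g t)).
Proof. by move=> cf cg t; apply: continuous_min; [exact: cf|exact: cg]. Qed.

Lemma continuous_addf (E : normedModType R) T (f g : T -> E) :
  continuous f -> continuous g -> continuous (fun t => f t + g t).
Proof. by move=> cf cg t; apply: cvgD; [exact: cf|exact: cg]. Qed.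

Lemma continuous_oppf (E : normedModType R) T (f : T -> E) :
  continuous f -> continuous (fun t => - f t).
Proof. by move=> cf t; apply: cvgN; exact: cf. Qed.

Lemma continuous_mulf T (f g : T -> R) :
  continuous f -> continuous g -> continuous (fun t => f t * g t).
Proof. by move=> cf cg t; apply: cvgM; [exact: cf|exact: cg]. Qed.

Lemma continuous_scalef (E : normedModType R) T (f : T -> R) (g : T -> E) :
  continuous f -> continuous g -> continuous (fun t => f t *: g t).
Proof. by move=> cf cg t; apply: cvgZ; [exact: cf|exact: cg]. Qed.

End Continuity.

Lemma continuous_id (T : topologicalType) : continuous (fun t : T => t).
Proof. by move=> t. Qed.

(* The partial applications in the middle are what unification leaves of maps
   such as t |-> 2 * t after eta reduction. *)
Ltac cts_body f := lazymatch f with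
  | (fun t => (_, _)) => apply: continuous_pair
  | (fun t => Num.max _ _) => apply: continuous_maxr
  | (fun t => Num.min _ _) => apply: continuous_minr
  | (fun t => _ *: _) => apply: continuous_scalef
  | (fun t => _ * _) => apply: continuous_mulf
  | (fun t => _ + _) => apply: continuous_addf
  | (fun t => - _) => apply: continuous_oppf
  | (fun t => t) => exact: continuous_id
  | (fun t => t.1) => exact: continuous_fst
  | (fun t => t.2) => exact: continuous_snd
  | GRing.mul _ => exact: (continuous_mulf (@cst_continuous _ _ _) (@continuous_id _))
  | +%R _ => exact: (continuous_addf (@cst_continuous _ _ _) (@continuous_id _))
  | -%R => exact: (continuous_oppf (@continuous_id _))
  | fst => exact: continuous_fst
  | snd => exact: continuous_snd
  | (fun _ => ?c) => exact: cst_continuous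
  | _ => assumption
  end.

Ltac cts := repeat (
  let x := fresh in
  intro x;
  lazymatch goal with |- @continuous_at _ _ _ ?f => revert x; cts_body f end).

Section Clamp.
Variable R : realType.
Implicit Types t : R.

Definition clamp t : R := Num.max 0 (Num.min t 1).

Lemma clamp_continuous : continuous clamp.
Proof. by rewrite /clamp; cts. Qed.

Lemma clamp_ge0 t : 0 <= clamp t. Proof. by rewrite /clamp le_max lexx. Qed.

Lemma clamp_le1 t : clamp t <= 1.
Proof. by rewrite /clamp ge_max ler01 /= ge_min lexx orbT. Qed.

Lemma clampE t : 0 <= t <= 1 -> clamp t = t.
Proof. by case/andP => t0 t1; rewrite /clamp min_l // max_r. Qed.

Lemma clamp0 : clamp 0 = 0. Proof. by apply: clampE; lra. Qed.
Lemma clamp1 : clamp 1 = 1. Proof. by apply: clampE; lra. Qed.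

End Clamp.

Arguments clamp {R}.

Section Half.
Variable R : realType.

Lemma one_le_half : (1 <= 2^-1 :> R) = false.
Proof. by apply/negbTE; lra. Qed.

Lemma two_mul1B1 : 2 * 1 - 1 = 1 :> R.
Proof. by lra. Qed.

(** Moving first along [ramp1] and then along [ramp2] is the staircase from
    (0, 0) to (1, 1) with corner (1, 0); concatenations factor through it. *)
Definition ramp1 (t : R) := Num.min (2 * t) 1.
Definition ramp2 (t : R) := Num.max 0 (2 * t - 1).

Lemma ramp1_continuous : continuous ramp1.
Proof. by rewrite /ramp1; cts. Qed.

Lemma ramp2_continuous : continuous ramp2.
Proof. by rewrite /ramp2; cts. Qed.

Lemma ramp_le t : t <= 2^-1 -> ramp1 t = 2 * t /\ ramp2 t = 0.
Proof. by move=> t2; rewrite /ramp1 /ramp2 min_l ?max_l //; lra. Qed.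

Lemma ramp_gt t : 2^-1 < t -> ramp1 t = 1 /\ ramp2 t = 2 * t - 1.
Proof. by move=> t2; rewrite /ramp1 /ramp2 min_r ?max_r //; lra. Qed.

Lemma ramp0 : ramp1 0 = 0 /\ ramp2 0 = 0.
Proof. by have [|-> ->] := @ramp_le 0; rewrite ?mulr0 ?invr_ge0. Qed.

Lemma ramp1E : ramp1 1 = 1 /\ ramp2 1 = 1.
Proof. by have [|-> ->] := @ramp_gt 1; rewrite ?two_mul1B1 ?ltNge ?one_le_half. Qed.

End Half.

Arguments ramp1 {R}.
Arguments ramp2 {R}.

(** * The fundamental groupoid *)

Section Paths.
Variables (R : realType) (M : topologicalType).
Implicit Types x y z : M.

(** Paths are maps of the whole line, of which only [0, 1] matters: continuity
    then needs no subspace topology, and gluing no boundary conditions. *)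
Record path x y := Path {
  pfun :> R -> M;
  pcont : continuous pfun;
  path0 : pfun 0 = x;
  path1 : pfun 1 = y }.

Definition homotopic x y (f g : path x y) : Prop := exists H : R * R -> M,
  [/\ continuous H,
      forall t : R, 0 <= t <= 1 -> H (t, 0) = f t /\ H (t, 1) = g t &
      forall s : R, 0 <= s <= 1 -> H (0, s) = x /\ H (1, s) = y].

(** The source of nearly all homotopies below: two curves in a vector space are
    joined by the straight-line homotopy, provided that the segments stay in the
    set [D] where the map [G] to M is continuous. *)
Lemma homotopic_segment (E : normedModType R) (D : set E) (G : E -> M)
    (phi psi : R -> E) x y (f g : path x y) :
  {within D, continuous G} -> continuous phi -> continuous psi ->
  (forall s t : R, 0 <= s <= 1 -> 0 <= t <= 1 ->
    D ((1 - s) *: phi t + s *: psi t)) ->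
  phi 0 = psi 0 -> phi 1 = psi 1 ->
  (forall t : R, 0 <= t <= 1 -> f t = G (phi t)) ->
  (forall t : R, 0 <= t <= 1 -> g t = G (psi t)) ->
  homotopic f g.
Proof.
move=> cG cphi cpsi DD e0 e1 ef eg.
have c (t : R) : 0 <= clamp t <= 1 by rewrite clamp_ge0 clamp_le1.
(* Clamping both parameters keeps the homotopy in [D] outside the square. *)
pose L (p : R * R) : E := (1 - clamp p.2) *: phi (clamp p.1)
                          + clamp p.2 *: psi (clamp p.1).
exists (G \o L); split.
- apply: (within_continuous_comp cG) => [|p]; last exact: DD.
  have c1 : continuous (fun p : R * R => clamp p.1).
    exact: (continuous_compf (@continuous_fst _ _) (@clamp_continuous R)).
  have c2 : continuous (fun p : R * R => clamp p.2).
    exact: (continuous_compf (@continuous_snd _ _) (@clamp_continuous R)).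
  rewrite /L; cts.
    exact: (continuous_compf c1 cphi).
  exact: (continuous_compf c1 cpsi).
- move=> t t01; rewrite /L /= clamp0 clamp1 !clampE // subr0 subrr.
  by rewrite !scale1r !scale0r add0r addr0 ef // eg.
- move=> s s01; rewrite /L /= clamp0 clamp1 !clampE // -e0 -e1.
  rewrite -!scalerDl subrK !scale1r -!ef ?path0 ?path1 //; lra.
Qed.

Lemma homotopic_line (E : normedModType R) (G : E -> M) (phi psi : R -> E) x y
    (f g : path x y) :
  continuous G -> continuous phi -> continuous psi ->
  phi 0 = psi 0 -> phi 1 = psi 1 ->
  (forall t : R, 0 <= t <= 1 -> f t = G (phi t)) ->
  (forall t : R, 0 <= t <= 1 -> g t = G (psi t)) ->
  homotopic f g.
Proof.
move=> cG cphi cpsi e0 e1; apply: (homotopic_segment (D := setT)) => //.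
exact: continuous_subspaceT.
Qed.

Lemma homotopic_eqfun x y (f g : path x y) :
  (forall t : R, 0 <= t <= 1 -> f t = g t) -> homotopic f g.
Proof.
move=> fg; apply: (@homotopic_line R f id id) => //; try exact: pcont.
- by cts.
- by cts.
- by move=> t /fg.
Qed.

Lemma homotopic_refl x y (f : path x y) : homotopic f f.
Proof. exact: homotopic_eqfun. Qed.

Lemma homotopic_sym x y (f g : path x y) : homotopic f g -> homotopic g f.
Proof.
move=> [H [cH H1 H2]]; exists (fun p => H (p.1, 1 - p.2)); split.
- apply: (@continuous_compf _ _ _ (fun p : R * R => (p.1, 1 - p.2))).
    by apply: continuous_pair; cts.
  exact: cH.
- by move=> t t01 /=; rewrite subr0 subrr; case: (H1 _ t01).
- by move=> s s01 /=; apply: H2; lra.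
Qed.

Lemma homotopic_trans x y (g f h : path x y) :
  homotopic f g -> homotopic g h -> homotopic f h.
Proof.
move=> [H [cH H1 H2]] [K [cK K1 K2]].
pose c (p : R * R) := clamp p.1.
have cc : continuous c.
  exact: (continuous_compf (@continuous_fst _ _) (@clamp_continuous R)).
exists (fun p => if p.2 <= 2^-1 then H (c p, 2 * p.2) else K (c p, 2 * p.2 - 1)).
split.
- apply: continuous_glue.
  + apply: (@continuous_compf _ _ _ (fun p : R * R => (c p, 2 * p.2))).
      by apply: continuous_pair; cts.
    exact: cH.
  + apply: (@continuous_compf _ _ _ (fun p : R * R => (c p, 2 * p.2 - 1))).
      by apply: continuous_pair; cts.
    exact: cK.
  + by cts.
  + move=> p ->; rewrite mulfV // subrr.
    have c01 : 0 <= c p <= 1 by rewrite clamp_ge0 clamp_le1.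
    by rewrite (H1 _ c01).2 (K1 _ c01).1.
- move=> t t01; rewrite /c /= clampE // ifT ?invr_ge0 //.
  by rewrite one_le_half mulr0 two_mul1B1 (H1 _ t01).1 (K1 _ t01).2.
- move=> s s01; rewrite /c /= clamp0 clamp1.
  by case: ifP => s2; [apply: H2|apply: K2]; lra.
Qed.

#[local] Hint Resolve homotopic_refl : core.

#[global] Instance homotopic_equiv x y : RelationClasses.Equivalence (@homotopic x y).
Proof.
split; [exact: homotopic_refl|exact: homotopic_sym|].
by move=> f g h; exact: homotopic_trans.
Qed.

Lemma concat_continuous x y z (f : path x y) (g : path y z) :
  continuous (loop_concat f g).
Proof.
apply: continuous_glue; [| |by cts|].
- apply: (@continuous_compf _ _ _ (fun t : R => 2 * t)); last exact: pcont.
  by cts.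
- apply: (@continuous_compf _ _ _ (fun t : R => 2 * t - 1)); last exact: pcont.
  by cts.
- by move=> t ->; rewrite mulfV // subrr path0 path1.
Qed.

Lemma concat0 x y z (f : path x y) (g : path y z) : loop_concat f g 0 = x.
Proof. by rewrite /loop_concat ifT ?invr_ge0 // mulr0 path0. Qed.

Lemma concat1 x y z (f : path x y) (g : path y z) : loop_concat f g 1 = z.
Proof.
by rewrite /loop_concat one_le_half two_mul1B1 path1.
Qed.

Definition pcat x y z (f : path x y) (g : path y z) : path x z :=
  Path (@concat_continuous _ _ _ f g) (concat0 f g) (concat1 f g).

Definition pcst x : path x x :=
  @Path x x (fun=> x) (@cst_continuous _ _ x) erefl erefl.

Lemma rev_continuous x y (f : path x y) : continuous (fun t : R => f (1 - t)).
Proof.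
apply: (@continuous_compf _ _ _ (fun t : R => 1 - t)); last exact: pcont.
by cts.
Qed.

Lemma rev0 x y (f : path x y) : f (1 - 0) = y.
Proof. by rewrite subr0 path1. Qed.

Lemma rev1 x y (f : path x y) : f (1 - 1) = x.
Proof. by rewrite subrr path0. Qed.

Definition pinv x y (f : path x y) : path y x :=
  Path (@rev_continuous _ _ f) (rev0 f) (rev1 f).

Local Notation "f ≈ g" := (homotopic f g) (at level 70).
Local Notation "f ** g" := (pcat f g) (at level 40, left associativity).

Lemma pcatE x y z (f : path x y) (g : path y z) t :
  (f ** g) t = if t <= 2^-1 then f (2 * t) else g (2 * t - 1).
Proof. by []. Qed.

Lemma pcat_cong x y z (f f' : path x y) (g g' : path y z) :
  f ≈ f' -> g ≈ g' -> f ** g ≈ f' ** g'.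
Proof.
move=> [H [cH H1 H2]] [K [cK K1 K2]].
pose c (p : R * R) := clamp p.2.
have cc : continuous c.
  exact: (continuous_compf (@continuous_snd _ _) (@clamp_continuous R)).
exists (fun p => if p.1 <= 2^-1 then H (2 * p.1, c p) else K (2 * p.1 - 1, c p)).
split.
- apply: continuous_glue.
  + apply: (@continuous_compf _ _ _ (fun p : R * R => (2 * p.1, c p))).
      by apply: continuous_pair; cts.
    exact: cH.
  + apply: (@continuous_compf _ _ _ (fun p : R * R => (2 * p.1 - 1, c p))).
      by apply: continuous_pair; cts.
    exact: cK.
  + by cts.
  + move=> p ->; rewrite mulfV // subrr.
    have c01 : 0 <= c p <= 1 by rewrite clamp_ge0 clamp_le1.
    by rewrite (H2 _ c01).2 (K2 _ c01).1.
- move=> t t01; rewrite /c /= clamp0 clamp1 /loop_concat.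
  by case: ifP => t2; [apply: H1|apply: K1]; lra.
- move=> s s01; rewrite /c /= clampE // ifT ?invr_ge0 //.
  by rewrite one_le_half mulr0 two_mul1B1 (H2 _ s01).1 (K2 _ s01).2.
Qed.

#[global] Instance pcat_proper x y z :
  Morphisms.Proper (Morphisms.respectful (@homotopic x y)
    (Morphisms.respectful (@homotopic y z) (@homotopic x z))) (@pcat x y z).
Proof. by move=> f f' ff' g g' gg'; exact: pcat_cong. Qed.

Lemma pcat1p x y (f : path x y) : pcst x ** f ≈ f.
Proof.
have [_ r0] := @ramp0 R; have [_ r1] := @ramp1E R.
apply: (@homotopic_line R f ramp2 id) => //.
- exact: pcont.
- exact: ramp2_continuous.
- by cts.
- move=> t t01; rewrite pcatE; case: leP => [/ramp_le|/ramp_gt] [_ ->] //.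
  by rewrite path0.
Qed.

Lemma pcatp1 x y (f : path x y) : f ** pcst y ≈ f.
Proof.
have [r0 _] := @ramp0 R; have [r1 _] := @ramp1E R.
apply: (@homotopic_line R f ramp1 id) => //.
- exact: pcont.
- exact: ramp1_continuous.
- by cts.
- move=> t t01; rewrite pcatE; case: leP => [/ramp_le|/ramp_gt] [-> _] //.
  by rewrite path1.
Qed.

Lemma pcatV x y (f : path x y) : f ** pinv f ≈ pcst x.
Proof.
apply: (@homotopic_line R f (fun t => Num.min (2 * t) (2 - 2 * t)) (fun=> 0)) => //.
- exact: pcont.
- by cts.
- by cts.
- by rewrite minEle ifT ?mulr0 //; lra.
- by rewrite minEle ifF; [lra|apply/negbTE; lra].
- move=> t t01; rewrite pcatE minEle; case: ifP => h; case: ifP => h' //=.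
  + by exfalso; lra.
  + by exfalso; lra.
  + by congr (f _); lra.
- by move=> t _ /=; rewrite path0.
Qed.

(** Both sides run through the same curve; the piecewise linear change of
    parameter between them is convex, hence a maximum of three affine maps. *)
Lemma pcatA x y z w (f : path x y) (g : path y z) (h : path z w) :
  f ** (g ** h) ≈ f ** g ** h.
Proof.
apply: (@homotopic_line R (f ** g ** h)
  (fun t => Num.max (t / 2) (Num.max (t - 4^-1) (2 * t - 1))) id) => //.
- exact: pcont.
- by cts.
- by cts.
- by rewrite !maxEle; case: ifP; case: ifP; lra.
- by rewrite !maxEle; case: ifP; case: ifP; lra.
- move=> t t01; rewrite !pcatE.
  set u := Num.max _ _.
  case: ifP => h1.
    have -> : u = t / 2 by rewrite /u !maxEle; case: ifP; case: ifP; lra.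
    rewrite ifT; last lra.
    by rewrite (_ : 2 * (t / 2) = t) ?h1 //; lra.
  case: ifP => h2.
    have -> : u = t - 4^-1 by rewrite /u !maxEle; case: ifP; case: ifP; lra.
    rewrite ifT; last lra.
    rewrite ifF; last by apply/negbTE; lra.
    by congr (g _); lra.
  have -> : u = 2 * t - 1 by rewrite /u !maxEle; case: ifP; case: ifP; lra.
  rewrite ifF; first by congr (h _); lra.
  by apply/negbTE; lra.
Qed.

Lemma pinvK x y (f : path x y) : pinv (pinv f) ≈ f.
Proof. by apply: homotopic_eqfun => t _ /=; congr (f _); lra. Qed.

Lemma pcatVp x y (f : path x y) : pinv f ** f ≈ pcst y.
Proof. by have := pcatV (pinv f); rewrite pinvK. Qed.

End Paths.

#[global] Hint Resolve homotopic_refl : core.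

Notation "f ≈ g" := (homotopic f g) (at level 70).
Notation "f ** g" := (pcat f g) (at level 40, left associativity).

(** * Subdivision of paths, and the fundamental group *)

Section LebesgueNumber.
Variable R : realType.

(** The local hypothesis holds uniformly near each point, so compactness lets one
    radius serve all points of [K]. *)
Lemma lebesgue_number (E : pseudoMetricType R) (K : set E)
    (Q : set E -> Prop) :
  compact K -> (forall A B : set E, A `<=` B -> Q B -> Q A) ->
  (forall x, K x -> exists2 e : R, 0 < e & Q (ball x e)) ->
  exists2 e : R, 0 < e & forall x, K x -> Q (ball x e).
Proof.
move=> /compact_near_coveringP cK QW KQ.
have : \forall e \near 0^'+, K `<=` (fun x => Q (ball x (e : R))).
  apply: cK => x /KQ[e e0 Qe].
  have e2 : 0 < e / 2 by rewrite divr_gt0.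
  near=> x' e' => /=; apply: QW Qe => y yx'.
  apply: (@ball_split _ _ x').
    by near: x'; exact: nbhsx_ballx.
  by apply: le_ball yx'; near: e'; exact: nbhs_right_le.
move=> KQe.
have : \forall e \near 0^'+, 0 < e /\ K `<=` (fun x => Q (ball x (e : R))).
  near=> e; split; [by near: e; exact: nbhs_right_gt|by near: e].
by move=> /filter_ex[e [e0 Ke]]; exists e.
Unshelve. all: by end_near. Qed.

(** Cousin's principle: repeated halving brings every subinterval below the
    Lebesgue number of the local hypothesis. *)
Lemma unit_interval_ind (C : R -> R -> Prop) :
  (forall s : R, 0 <= s <= 1 -> exists2 e : R, 0 < e & forall s1 s2 : R,
    0 <= s1 -> s1 <= s2 -> s2 <= 1 -> `|s - s1| < e -> `|s - s2| < e ->
    C s1 s2) ->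
  (forall s t : R, 0 <= s -> s <= t -> t <= 1 ->
    C s ((s + t) / 2) -> C ((s + t) / 2) t -> C s t) ->
  C 0 1.
Proof.
move=> Cloc Cadd.
pose Q (U : set R) := forall s1 s2 : R,
  0 <= s1 -> s1 <= s2 -> s2 <= 1 -> U s1 -> U s2 -> C s1 s2.
have [||e e0 Qe] := @lebesgue_number R `[0, 1]%classic Q (@segment_compact R 0 1).
- by move=> U V UV QV s1 s2 ? ? ? ? ?; apply: QV => //; exact: UV.
- move=> s; rewrite /= in_itv /= => /Cloc[e e0 Ce]; exists e => //.
have short n (s t : R) : 0 <= s -> s <= t -> t <= 1 -> t - s < e * 2 ^+ n -> C s t.
  elim: n s t => [|n IHn] s t s0 st t1 ste.
    have sI : `[0, 1]%classic s by rewrite /= in_itv /= s0 (le_trans st).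
    apply: (Qe _ sI) => //; first exact: ballxx.
    by rewrite /ball /= distrC ger0_norm ?subr_ge0 // -[e]mulr1.
  by rewrite exprS in ste; apply: Cadd => //; apply: IHn; lra.
have [n en] : exists n : nat, e^-1 < n%:R.
  by exists (Num.truncn e^-1).+1; exact: truncnS_gt.
apply: (short n) => //; rewrite subr0 -ltr_pdivrMl // mulr1 (lt_le_trans en) //.
by rewrite -natrX ler_nat ltnW // ltn_expl.
Qed.

End LebesgueNumber.

Section Subdivision.
Variables (R : realType) (M : topologicalType).
Implicit Types (x y z : M).

Lemma subpath_continuous x y (f : path R x y) s t :
  continuous (fun r : R => f (s + r * (t - s))).
Proof.
apply: (@continuous_compf _ _ _ (fun r : R => s + r * (t - s))); last exact: pcont.
by cts.
Qed.

(** The form in which paths are cut into short pieces: [S] only has to be known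
    for paths inside members of an open cover. The pieces are again elements of
    the type of paths, between the points that the subdivision produces. *)
Lemma path_subdivision (S : forall x y, path R x y -> Prop) :
  (forall x y (f g : path R x y), f ≈ g -> S x y f -> S x y g) ->
  (forall x y z (f : path R x y) (g : path R y z),
    S x y f -> S y z g -> S x z (f ** g)) ->
  forall x y (f : path R x y),
  (forall s : R, 0 <= s <= 1 -> exists2 U, nbhs (f s) U &
    forall a b (g : path R a b), (forall t : R, 0 <= t <= 1 -> U (g t)) ->
      S a b g) ->
  S x y f.
Proof.
move=> Sheq Scat x y f Sloc.
pose C (s t : R) := forall a b (g : path R a b),
  (forall r : R, 0 <= r <= 1 -> g r = f (s + r * (t - s))) -> S a b g.
suff : C 0 1 by apply=> r _; congr (f _); ring.
apply: unit_interval_ind => [s s01|s t s0 st t1 Csm Cmt a b g gE].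
  have [U fU SU] := Sloc s s01.
  have /nbhs_ballP[e /= e0 eU] : nbhs s (f @^-1` U) by exact: (@pcont _ _ _ _ f s U fU).
  exists e => // s1 s2 s10 s12 s21 s1e s2e a b g gE; apply: SU => t t01.
  rewrite gE //; apply: eU; rewrite /ball /=.
  have tl : 0 <= t * (s2 - s1) by rewrite mulr_ge0 ?subr_ge0 //; case/andP: t01.
  have tu : t * (s2 - s1) <= s2 - s1.
    by rewrite ler_piMl ?subr_ge0 //; case/andP: t01.
  by move: s1e s2e; rewrite !ltr_norml => /andP[? ?] /andP[? ?]; lra.
have g1 : g 2^-1 = f ((s + t) / 2) by rewrite gE; [congr (f _); lra|lra].
have ga : f (s + 0 * (t - s)) = a.
  by rewrite -(path0 g) gE //; lra.
have gb : f ((s + t) / 2 + 1 * (t - (s + t) / 2)) = b.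
  by rewrite -(path1 g) gE; [congr (f _); lra|lra].
have ga' : f (s + 0 * ((s + t) / 2 - s)) = a by rewrite -ga; congr (f _); lra.
have gm : f (s + 1 * ((s + t) / 2 - s)) = f ((s + t) / 2).
  by congr (f _); lra.
have gm' : f ((s + t) / 2 + 0 * (t - (s + t) / 2)) = f ((s + t) / 2).
  by congr (f _); lra.
pose g1' := Path (@subpath_continuous _ _ f s ((s + t) / 2)) ga' gm.
pose g2' := Path (@subpath_continuous _ _ f ((s + t) / 2) t) gm' gb.
apply: (Sheq _ _ (g1' ** g2')); last by apply: Scat; [exact: Csm|exact: Cmt].
apply: homotopic_eqfun => r r01; rewrite pcatE gE //=.
by case: ifP => r2; congr (f _); lra.
Qed.

End Subdivision.

Section LoopClasses.
Variables (R : realType) (M : topologicalType) (x0 : M).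
Implicit Types p q : path R x0 x0.

Lemma loop_path (f : R -> M) : is_loop x0 f ->
  exists p : path R x0 x0, forall t : R, 0 <= t <= 1 -> p t = f t.
Proof.
case=> cf f0 f1.
have cfc : continuous (f \o clamp).
  apply: (within_continuous_comp cf); first exact: clamp_continuous.
  by move=> t /=; rewrite in_itv /= clamp_ge0 clamp_le1.
have fc0 : (f \o clamp) 0 = x0 by rewrite /= clamp0.
have fc1 : (f \o clamp) 1 = x0 by rewrite /= clamp1.
by exists (Path cfc fc0 fc1) => t t01 /=; rewrite clampE.
Qed.

Lemma path_is_loop (f : R -> M) p :
  (forall t : R, 0 <= t <= 1 -> p t = f t) -> is_loop x0 f.
Proof.
move=> pf; split; last 2 first.
- by rewrite -pf ?path0 //; lra.
- by rewrite -pf ?path1 //; lra.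
- apply: (@subspace_eq_continuous _ _ _ p) => [t|].
    by rewrite inE /= in_itv /=; exact: pf.
  by apply: continuous_subspaceT; exact: pcont.
Qed.

(** Clamping turns homotopies on the closed square into maps of the plane, so
    loops and homotopies on [0, 1] are faithfully represented by [path]. *)
Lemma loop_homotopicP (f g : R -> M) p q :
  (forall t : R, 0 <= t <= 1 -> p t = f t) ->
  (forall t : R, 0 <= t <= 1 -> q t = g t) ->
  loop_homotopic x0 f g <-> p ≈ q.
Proof.
move=> pf qg; split=> -[H [cH H1 H2]].
- exists (fun u => H (clamp u.1, clamp u.2)); split.
  + apply: (within_continuous_comp cH (f := fun u : R * R => (clamp u.1, clamp u.2))).
      apply: continuous_pair.
        exact: (continuous_compf (@continuous_fst _ _) (@clamp_continuous R)).
      exact: (continuous_compf (@continuous_snd _ _) (@clamp_continuous R)).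
    by move=> u; split; rewrite /= in_itv /= clamp_ge0 clamp_le1.
  + move=> t t01 /=; rewrite clampE // clamp0 clamp1 pf // qg //.
    by apply: H1; rewrite /= in_itv.
  + move=> s s01 /=; rewrite clamp0 clamp1 [clamp s]clampE //.
    by apply: H2; rewrite /= in_itv.
- exists H; split; first exact: continuous_subspaceT.
    by move=> t /=; rewrite in_itv /= => t01; rewrite -pf // -qg //; exact: H1.
  by move=> s /=; rewrite in_itv /= => s01; exact: H2.
Qed.

Lemma loop_classE (f : R -> M) p g : (forall t : R, 0 <= t <= 1 -> p t = f t) ->
  loop_class x0 f g <->
  exists2 q, p ≈ q & forall t : R, 0 <= t <= 1 -> q t = g t.
Proof.
move=> pf; split=> [[gl fg]|[q pq qg]].
  have [q qg] := loop_path gl; exists q => //.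
  exact/(loop_homotopicP pf qg).
split; first exact: path_is_loop qg.
exact/(loop_homotopicP pf qg).
Qed.

Lemma eq_loop_class (f g : R -> M) p q :
  (forall t : R, 0 <= t <= 1 -> p t = f t) ->
  (forall t : R, 0 <= t <= 1 -> q t = g t) ->
  p ≈ q -> loop_class x0 f = loop_class x0 g.
Proof.
move=> pf qg pq; apply/seteqP; split=> h /=.
- move=> /(loop_classE _ pf)[r pr rh]; apply/(loop_classE _ qg).
  by exists r => //; rewrite -pq.
- move=> /(loop_classE _ qg)[r qr rh]; apply/(loop_classE _ pf).
  by exists r => //; rewrite pq.
Qed.

Definition loop_cls p := loop_class x0 p.

Lemma eq_loop_cls p q : p ≈ q -> loop_cls p = loop_cls q.
Proof. exact: eq_loop_class. Qed.

Lemma pi1P u : pi1 R x0 u <-> exists p, u = loop_cls p.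
Proof.
split=> [[f lf <-]|[p ->]].
  have [p pf] := loop_path lf; exists p.
  exact: (eq_loop_class pf (fun _ _ => erefl) (homotopic_refl p)).
by exists p => //; exact: (path_is_loop (p := p)).
Qed.

Lemma pi1_mulE p q : pi1_mul x0 (loop_cls p) (loop_cls q) = loop_cls (p ** q).
Proof.
have loop_clsE (r : path R x0 x0) : forall t : R, 0 <= t <= 1 -> r t = pfun r t by [].
have catE (r s : path R x0 x0) (f g : R -> M) :
    (forall t : R, 0 <= t <= 1 -> r t = f t) ->
    (forall t : R, 0 <= t <= 1 -> s t = g t) ->
    forall t : R, 0 <= t <= 1 -> (r ** s) t = loop_concat f g t.
  move=> rf sg t t01; rewrite pcatE /loop_concat.
  by case: ifP => t2; [apply: rf|apply: sg]; lra.
apply/seteqP; split=> h.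
- move=> [f [g [/(loop_classE _ (loop_clsE p))[r pr rf]
                /(loop_classE _ (loop_clsE q))[s qs sg] ]]].
  move=> /(loop_classE _ (catE _ _ _ _ rf sg))[w rsw wh].
  apply/(loop_classE _ (loop_clsE (p ** q))); exists w => //.
  by rewrite pr qs.
- move=> hpq; exists p, q; split.
  + by apply/(loop_classE _ (loop_clsE p)); exists p.
  + by apply/(loop_classE _ (loop_clsE q)); exists q.
  + exact: hpq.
Qed.

Lemma pi1_finite_abelian (T : finType) (F : T -> path R x0 x0) :
  (forall p q, p ** q ≈ q ** p) -> (forall p, exists i, p ≈ F i) ->
  finite_abelian_group (pi1 R x0) (pi1_mul x0) (pi1_one R x0).
Proof.
move=> comm fin.
have oneE : pi1_one R x0 = loop_cls (pcst R x0) by [].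
split.
- split=> [x y /pi1P[p ->] /pi1P[q ->]|x y z /pi1P[p ->] /pi1P[q ->] /pi1P[r ->]].
    by rewrite pi1_mulE; apply/pi1P; exists (p ** q).
  by rewrite !pi1_mulE; apply: eq_loop_cls; exact: pcatA.
- split; first by apply/pi1P; exists (pcst R x0).
  move=> x /pi1P[p ->]; rewrite oneE !pi1_mulE.
  by split; apply: eq_loop_cls; [exact: pcat1p|exact: pcatp1].
- move=> x /pi1P[p ->]; exists (loop_cls (pinv p)); rewrite oneE !pi1_mulE; split.
  + by apply/pi1P; exists (pinv p).
  + by apply: eq_loop_cls; exact: pcatVp.
  + by apply: eq_loop_cls; exact: pcatV.
- by move=> x y /pi1P[p ->] /pi1P[q ->]; rewrite !pi1_mulE; exact: eq_loop_cls.
- apply: (@sub_finite_set _ _ ((loop_cls \o F) @` [set: T])).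
    move=> u /pi1P[p ->]; have [i pi] := fin p; exists i => //=.
    by apply: eq_loop_cls; rewrite pi.
  exact: finite_image.
Qed.

End LoopClasses.

(** * Lifting paths of the circle *)

Section Rows.
Variable R : realType.

Lemma continuous_row (T : topologicalType) n (f : T -> 'rV[R]_n) :
  (forall j, continuous (fun t => f t 0 j)) -> continuous f.
Proof.
move=> cf t; apply/cvg_ballP => e e0.
have : \forall s \near t, forall j, ball (f t 0 j) e (f s 0 j).
  by apply: filter_forall => j; have /cvg_ballP := cf j t; exact.
by apply: filterS => s fs; split => // i j; rewrite (ord1 i); exact: fs.
Qed.

Lemma continuous_coord (T : topologicalType) n (f : T -> 'rV[R]_n) j :
  continuous f -> continuous (fun t => f t 0 j).
Proof. by move=> cf; exact: (continuous_compf cf (@coord_continuous _ _ _ 0 j)). Qed.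

End Rows.

Section Circle.
Variable R : realType.
Implicit Types a b c s t : R.

Lemma circle_arg c s : c ^+ 2 + s ^+ 2 = 1 ->
  exists a, cos a = c /\ sin a = s.
Proof.
move=> cs; have c1 : -1 <= c <= 1 by nra.
have sq : Num.sqrt (1 - c ^+ 2) = `|s| by rewrite -sqrtr_sqr; congr Num.sqrt; lra.
have [s0|s0] := leP 0 s.
  exists (acos c); rewrite sin_acos // sq ger0_norm //; split => //.
  by apply: acosK; rewrite in_itv.
exists (- acos c); rewrite cosN sinN sin_acos // sq ltr0_norm // opprK.
by split => //; apply: acosK; rewrite in_itv.
Qed.

Lemma sinD2piz a (n : int) : sin (a + 2 * pi * n%:~R) = sin a.
Proof.
have pn (m : nat) b : sin (b + 2 * pi * m%:R) = sin b.
  rewrite -[RHS](periodicn (@sinD2pi R) m b) -mulr_natr -[pi *+ 2]mulr_natl.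
  by congr (sin (_ + _)); ring.
case: n => m; first exact: pn.
by rewrite NegzE -[LHS](pn m.+1) mulrNz /= mulrN addrNK.
Qed.

Lemma cosD2piz a (n : int) : cos (a + 2 * pi * n%:~R) = cos a.
Proof.
have pn (m : nat) b : cos (b + 2 * pi * m%:R) = cos b.
  rewrite -[RHS](periodicn (@cosD2pi R) m b) -mulr_natr -[pi *+ 2]mulr_natl.
  by congr (cos (_ + _)); ring.
case: n => m; first exact: pn.
by rewrite NegzE -[LHS](pn m.+1) mulrNz /= mulrN addrNK.
Qed.

Lemma cos2pi_eq1 t : cos (2 * pi * t) = 1 -> exists n : int, t = n%:~R.
Proof.
move=> ct; exists (Num.floor t).
pose u := t - (Num.floor t)%:~R.
have u0 : 0 <= u by rewrite subr_ge0 floor_le_tmp.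
have u1 : u < 1.
  by rewrite ltrBlDr; have := floorD1_gt t; rewrite intrD addrC.
have cu : cos (2 * pi * u) = 1.
  rewrite -[RHS]ct -[LHS](cosD2piz _ (Num.floor t)).
  by congr cos; rewrite /u; ring.
suff : u = 0 by move/eqP; rewrite subr_eq0 => /eqP.
have p0 := pi_gt0 R.
have inj (v : R) : 0 <= v -> v <= 2^-1 -> cos (2 * pi * v) = 1 -> v = 0.
  move=> v0 v2 cv; have : 2 * pi * v = 0.
    by apply: cos_inj; rewrite ?cos0 // in_itv /=; apply/andP; split; nra.
  by move/eqP; rewrite mulf_eq0 (gt_eqF (_ : 0 < 2 * pi)) ?mulr_gt0 // => /eqP.
have [u2|u2] := leP u 2^-1; first exact: inj.
suff : 1 - u = 0 by lra.
apply: inj; [lra|lra|].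
rewrite -[RHS]cu -[RHS]cosN -[RHS](cosD2piz _ 1) mulr1z.
by congr cos; ring.
Qed.

(** Covering space theory of the circle, by hand: on a short interval [u, v] the
    point (c, s) stays within a quarter turn of its position at u, and the angle
    swept is the arcsine of the sine of the difference. Lifts on adjacent
    intervals are glued, which is why the initial angle is arbitrary in [C]. *)
Lemma circle_lift (c s : R -> R) :
  continuous c -> continuous s -> (forall t, c t ^+ 2 + s t ^+ 2 = 1) ->
  c 0 = 1 -> s 0 = 0 ->
  exists phi : R -> R, [/\ continuous phi, phi 0 = 0 &
    forall t, 0 <= t <= 1 -> c t = cos (phi t) /\ s t = sin (phi t)].
Proof.
move=> cc cs cs1 c0 s0.
pose C (u v : R) := forall a, c u = cos a -> s u = sin a ->
  exists phi : R -> R, [/\ continuous phi, phi u = a &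
    forall t, u <= t <= v -> c t = cos (phi t) /\ s t = sin (phi t)].
suff : C 0 1 by apply; rewrite ?cos0 ?sin0.
apply: unit_interval_ind => [r r01|u v u0 uv v1 C1 C2 a ca sa]; last first.
  have [phi [cphi phiu Hphi]] := C1 a ca sa.
  have [|cm sm] := Hphi ((u + v) / 2); first lra.
  have [psi [cpsi psim Hpsi]] := C2 _ cm sm.
  exists (fun t => if t <= (u + v) / 2 then phi t else psi t); split.
  - by apply: continuous_glue => // [|t ->]; [cts|rewrite psim].
  - by rewrite ifT //; lra.
  - move=> t tuv; case: ifP => tm; first by apply: Hphi; lra.
    by apply: Hpsi; lra.
have /cvgrPdist_lt/(_ 4^-1) c4 := cc r.
have /cvgrPdist_lt/(_ 4^-1) s4 := cs r.
have [e e0 ee] : exists2 e : R, 0 < e & forall t, `|r - t| < e ->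
    `|c r - c t| < 4^-1 /\ `|s r - s t| < 4^-1.
  suff : nbhs r (fun t => `|c r - c t| < 4^-1 /\ `|s r - s t| < 4^-1).
    by move=> /nbhs_ballP[e /= e0 ee]; exists e.
  near=> t; split; near: t; [apply: c4|apply: s4]; lra.
exists e => // u v u0 uv v1 ue ve a ca sa.
pose k t := Num.max u (Num.min t v).
have ck : continuous k by rewrite /k; cts.
have kuv t : u <= k t <= v by rewrite /k le_max lexx /= ge_max uv ge_min lexx orbT.
have kE t : u <= t <= v -> k t = t by case/andP => ? ?; rewrite /k min_l // max_r.
(* Sine and cosine of the angle swept since [u]; [k] freezes the motion outside
   [u, v]. *)
pose D t := s (k t) * cos a - c (k t) * sin a.
pose G t := c (k t) * cos a + s (k t) * sin a.
have DG t : D t ^+ 2 + G t ^+ 2 = 1.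
  rewrite -[RHS](mulr1 1) -{1}(cs1 (k t)) -(cos2Dsin2 a) /D /G; ring.
have G0 t : 0 < G t.
  have [|c1 s1] := ee u; first by [].
  have [|c2 s2] := ee (k t).
    have := kuv t; move: ue ve; rewrite !ltr_norml => /andP[? ?] /andP[? ?] /andP[? ?].
    lra.
  rewrite /G -ca -sa; move: (cs1 u) (cs1 (k t)).
  move: c1 s1 c2 s2; rewrite !ltr_norml.
  move: (c u) (s u) (c (k t)) (s (k t)) => x y z w.
  move=> /andP[? ?] /andP[? ?] /andP[? ?] /andP[? ?] ? ?.
  (* The cosine of the angle between two unit vectors is 1 minus half of the
     squared distance between them. *)
  have sq (d : R) : - 2^-1 < d -> d < 2^-1 -> d ^+ 2 < 4^-1.
    by move=> ? ?; nra.
  have d1 : (x - z) ^+ 2 < 4^-1 by apply: sq; lra.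
  have d2 : (y - w) ^+ 2 < 4^-1 by apply: sq; lra.
  nra.
have D1 t : -1 < D t < 1 by have := DG t; have := G0 t; move: (D t) (G t) => x y; nra.
have Gsq t : Num.sqrt (1 - D t ^+ 2) = G t.
  have -> : 1 - D t ^+ 2 = G t ^+ 2 by have := DG t; lra.
  by rewrite sqrtr_sqr gtr0_norm.
have D1' t : -1 <= D t <= 1 by have := D1 t; lra.
exists (fun t => a + asin (D t)); split.
- have cD : continuous D.
    rewrite /D; cts; exact: (continuous_compf ck).
  apply: continuous_addf; first exact: cst_continuous.
  move=> t; apply: continuous_comp; [exact: cD|exact: continuous_asin].
- have -> : D u = 0 by rewrite /D kE ?lexx //= ca sa mulrC subrr.
  rewrite -{2}[a]addr0; congr (_ + _); rewrite -{1}sin0 sinK // in_itv /=.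
  by have := pi_gt0 R; lra.
- move=> t tuv; rewrite cosD sinD cos_asin // Gsq asinK ?in_itv /= ?D1' //.
  rewrite /D /G kE //; have := cos2Dsin2 a.
  move: (cos a) (sin a) (c t) (s t) => x y z w xy.
  by split; rewrite -[LHS]mulr1 -xy; ring.
Unshelve. all: by end_near. Qed.

End Circle.

(** * The torus and its exponential map *)

Section TorusExp.
Variables (R : realType) (N : nat).
Implicit Types (t s z w : cspace R N) (u v : 'rV[R]_N).

Lemma cspaceP z w :
  (forall j, z.1 0 j = w.1 0 j /\ z.2 0 j = w.2 0 j) -> z = w.
Proof.
case: z w => z1 z2 [w1 w2] /= zw.
by congr (_, _); apply/rowP => j; case: (zw j).
Qed.

Lemma cmul1E z w j : (cmul z w).1 0 j = z.1 0 j * w.1 0 j - z.2 0 j * w.2 0 j.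
Proof. by rewrite /cmul /of_coord /ccoord !mxE. Qed.

Lemma cmul2E z w j : (cmul z w).2 0 j = z.1 0 j * w.2 0 j + z.2 0 j * w.1 0 j.
Proof. by rewrite /cmul /of_coord /ccoord !mxE. Qed.

Lemma cone1E j : (cone R N).1 0 j = 1. Proof. by rewrite !mxE. Qed.
Lemma cone2E j : (cone R N).2 0 j = 0. Proof. by rewrite !mxE. Qed.

Definition cmulE := (cmul1E, cmul2E, cone1E, cone2E).

Lemma cmulA z w t : cmul z (cmul w t) = cmul (cmul z w) t.
Proof. by apply: cspaceP => j; rewrite !cmulE; split; ring. Qed.

Lemma cmul1 z : cmul (cone R N) z = z.
Proof. by apply: cspaceP => j; rewrite !cmulE; split; ring. Qed.

Lemma ccoord_norm_eq1 z j :
  `|ccoord z j| = 1 <-> z.1 0 j ^+ 2 + z.2 0 j ^+ 2 = 1.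
Proof.
rewrite /ccoord normc_def /=; split=> [[h]|->]; last by rewrite sqrtr1.
by rewrite -[LHS]sqr_sqrtr ?addr_ge0 ?sqr_ge0 // h expr1n.
Qed.

Lemma torusP t : torus t <-> forall j, t.1 0 j ^+ 2 + t.2 0 j ^+ 2 = 1.
Proof. by split=> h j; apply/ccoord_norm_eq1; exact: h. Qed.

Lemma cone_torus : torus (cone R N).
Proof. by apply/torusP => j; rewrite !cmulE; ring. Qed.

Lemma torus_mul t s : torus t -> torus s -> torus (cmul t s).
Proof.
move=> /torusP tt /torusP ts; apply/torusP => j; rewrite !cmulE.
rewrite -[RHS](mulr1 1) -{1}(tt j) -(ts j); ring.
Qed.

Lemma cmul_continuous (T : topologicalType) (f g : T -> cspace R N) :
  continuous f -> continuous g -> continuous (fun x => cmul (f x) (g x)).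
Proof.
move=> cf cg.
have c1 (h : T -> cspace R N) j : continuous h -> continuous (fun x => (h x).1 0 j).
  by move=> ch; apply: continuous_coord; exact: (continuous_compf ch (@continuous_fst _ _)).
have c2 (h : T -> cspace R N) j : continuous h -> continuous (fun x => (h x).2 0 j).
  by move=> ch; apply: continuous_coord; exact: (continuous_compf ch (@continuous_snd _ _)).
apply: continuous_pair; apply: continuous_row => j;
  have h1 := c1 f j cf; have h2 := c1 g j cg;
  have h3 := c2 f j cf; have h4 := c2 g j cg.
- rewrite (_ : (fun _ => _) = fun x =>
    (f x).1 0 j * (g x).1 0 j + - ((f x).2 0 j * (g x).2 0 j)).
    by cts.
  by apply/funext => x; rewrite -cmul1E.
- rewrite (_ : (fun _ => _) = fun x =>
    (f x).1 0 j * (g x).2 0 j + (f x).2 0 j * (g x).1 0 j).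
    by cts.
  by apply/funext => x; rewrite -cmul2E.
Qed.

Definition cconj z : cspace R N := (z.1, - z.2).

Lemma torus_conj t : torus t -> torus (cconj t).
Proof. by move=> /torusP tt; apply/torusP => j; rewrite !mxE /= sqrrN. Qed.

Lemma cmulV t : torus t -> cmul (cconj t) t = cone R N.
Proof.
move=> /torusP tt; apply: cspaceP => j; rewrite !cmulE !mxE /=.
by split; [rewrite -(tt j)|]; ring.
Qed.

(** The universal cover of the torus, normalized so that its kernel is Z^N. *)
Definition expT v : cspace R N :=
  (\row_j cos (2 * pi * v 0 j), \row_j sin (2 * pi * v 0 j)).

Lemma expT_torus v : torus (expT v).
Proof. by apply/torusP => j; rewrite !mxE cos2Dsin2. Qed.

Lemma expT_continuous : continuous expT.
Proof.
apply: continuous_pair; apply: continuous_row => j.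
- rewrite (_ : (fun _ => _) = fun v => cos (2 * pi * v 0 j)); last first.
    by apply/funext => v; rewrite mxE.
  apply: (@continuous_compf _ _ _ (fun v : 'rV[R]_N => 2 * pi * v 0 j)).
    by apply: continuous_mulf; [cts|exact: coord_continuous].
  exact: continuous_cos.
- rewrite (_ : (fun _ => _) = fun v => sin (2 * pi * v 0 j)); last first.
    by apply/funext => v; rewrite mxE.
  apply: (@continuous_compf _ _ _ (fun v : 'rV[R]_N => 2 * pi * v 0 j)).
    by apply: continuous_mulf; [cts|exact: coord_continuous].
  exact: continuous_sin.
Qed.

Lemma expT0 : expT 0 = cone R N.
Proof. by apply: cspaceP => j; rewrite !mxE !mulr0 cos0 sin0. Qed.

Lemma expTD u v : expT (u + v) = cmul (expT u) (expT v).
Proof.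
apply: cspaceP => j; rewrite !cmulE !mxE mulrDr cosD sinD; split=> //.
by rewrite addrC mulrC [X in _ = X + _]mulrC [X in _ = _ + X]mulrC; ring.
Qed.

Lemma expT_surj t : torus t -> exists v, expT v = t.
Proof.
move=> /torusP tt.
have /choice[a aE] j : exists a, cos a = t.1 0 j /\ sin a = t.2 0 j.
  exact: circle_arg.
have p0 : 2 * pi != 0 :> R by rewrite mulf_neq0 // gt_eqF // pi_gt0.
exists (\row_j (a j / (2 * pi))); apply: cspaceP => j.
by rewrite !mxE mulrC mulfVK //; exact: aE.
Qed.

Definition rowR (v : 'rV[int]_N) : 'rV[R]_N := map_mx intr v.

Lemma rowR_is_additive : {morph rowR : x y / x + y}.
Proof. by move=> u v; apply/rowP => j; rewrite !mxE intrD. Qed.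

Lemma expT_int (v : 'rV[int]_N) : expT (rowR v) = cone R N.
Proof.
apply: cspaceP => j; rewrite !mxE -[2 * pi * _]add0r.
by rewrite cosD2piz sinD2piz cos0 sin0.
Qed.

Lemma expT_eq1 v : expT v = cone R N -> exists u : 'rV[int]_N, v = rowR u.
Proof.
move=> ve; have /choice[u uE] j : exists n : int, v 0 j = n%:~R.
  apply: cos2pi_eq1; move: (congr1 (fun z : cspace R N => z.1 0 j) ve).
  by rewrite !mxE.
by exists (\row_j u j); apply/rowP => j; rewrite !mxE uE.
Qed.

Lemma expT_lift (g : R -> cspace R N) :
  continuous g -> (forall r : R, torus (g r)) -> g 0 = cone R N ->
  exists phi : R -> 'rV[R]_N, [/\ continuous phi, phi 0 = 0 &
    forall t : R, 0 <= t <= 1 -> g t = expT (phi t)].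
Proof.
move=> cg gT g0.
have p0 : 2 * pi != 0 :> R by rewrite mulf_neq0 // gt_eqF // pi_gt0.
have /choice[psi psiP] j : exists psi : R -> R, [/\ continuous psi, psi 0 = 0 &
    forall t : R, 0 <= t <= 1 ->
      (g t).1 0 j = cos (psi t) /\ (g t).2 0 j = sin (psi t)].
  apply: circle_lift.
  - apply: continuous_coord; exact: (continuous_compf cg (@continuous_fst _ _)).
  - apply: continuous_coord; exact: (continuous_compf cg (@continuous_snd _ _)).
  - by move=> t; have /torusP := gT t; exact.
  - by rewrite g0 cone1E.
  - by rewrite g0 cone2E.
exists (fun t : R => \row_j (psi j t / (2 * pi))); split.
- apply: continuous_row => j; have [cpsi _ _] := psiP j.
  rewrite (_ : (fun _ => _) = fun t : R => psi j t / (2 * pi)); first by cts.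
  by apply/funext => t; rewrite mxE.
- by apply/rowP => j; have [_ psi0 _] := psiP j; rewrite !mxE psi0 mul0r.
- move=> t t01; apply: cspaceP => j; have [_ _ /(_ t t01)] := psiP j.
  by rewrite !mxE [2 * pi * _]mulrC mulfVK.
Qed.

Lemma expi_exprz (a : R) (n : int) :
  (Complex (cos a) (sin a)) ^ n = Complex (cos (n%:~R * a)) (sin (n%:~R * a)).
Proof.
have eD x y : Complex (cos x) (sin x) * Complex (cos y) (sin y)
    = Complex (cos (x + y)) (sin (x + y)) :> R[i].
  by rewrite cosD sinD [in RHS]addrC; congr Complex; ring.
have en (m : nat) : (Complex (cos a) (sin a)) ^+ m
    = Complex (cos (m%:R * a)) (sin (m%:R * a)) :> R[i].
  elim: m => [|m IHm]; first by rewrite mul0r cos0 sin0.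
  by rewrite exprSr IHm eD -natr1 mulrDl mul1r.
case: n => m; first exact: en.
rewrite -[LHS]/(_ ^- m.+1) en NegzE; apply: mulr1_eq; rewrite eD -mulrDl.
by rewrite mulrNz /= subrr mul0r cos0 sin0.
Qed.

Lemma expT_circle_of (v : 'rV[int]_N) (t : R) :
  circle_of v (expT (t *: rowR v)).
Proof.
exists (Complex (cos (2 * pi * t)) (sin (2 * pi * t))).
  by rewrite /= normc_def /= cos2Dsin2 sqrtr1.
apply: cspaceP => j; rewrite /cochar /of_coord !mxE !expi_exprz /=.
by split; congr (_ _); ring.
Qed.

Lemma torus_compact : compact (@torus R N).
Proof.
have segc : compact ([set v : 'rV[R]_N | forall j, `[-1, 1]%classic (v 0 j)]
    `*` [set v : 'rV[R]_N | forall j, `[-1, 1]%classic (v 0 j)]).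
  have c1 := @rV_compact R N (fun=> `[-1, 1]%classic) (fun=> @segment_compact R _ _).
  exact: compact_setX.
apply: (subclosed_compact _ segc) => [|t /torusP tt]; last first.
  by split=> j /=; rewrite in_itv /=; have := tt j; nra.
rewrite (_ : @torus R N = \bigcap_(j in [set: 'I_N])
    (fun t : cspace R N => t.1 0 j ^+ 2 + t.2 0 j ^+ 2) @^-1` [set 1]).
  apply: closed_bigI => j _; apply: preimage_closed; last exact: closed_eq.
  have c1 : continuous (fun t : cspace R N => t.1 0 j).
    by apply: continuous_coord; cts.
  have c2 : continuous (fun t : cspace R N => t.2 0 j).
    by apply: continuous_coord; cts.
  have : continuous (fun t : cspace R N => t.1 0 j ^+ 2 + t.2 0 j ^+ 2).
    by apply: continuous_addf; apply: continuous_mulf.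
  by move=> c t _; exact: c.
apply/seteqP; split=> t; first by move=> /torusP tt j _; exact: tt.
by move=> tt; apply/torusP => j; exact: tt.
Qed.

End TorusExp.

(** A continuous injection of a compact space into a Hausdorff space is an
    embedding. Stated without naming an inverse, so as to apply to a curve chosen
    pointwise in the compact space. *)
Lemma continuous_factor_compact (Z T U : topologicalType) (K : set T)
    (theta : T -> U) (g : Z -> T) :
  hausdorff_space U -> compact K -> {within K, continuous theta} ->
  {in K &, injective theta} -> (forall z, K (g z)) ->
  continuous (theta \o g) -> continuous g.
Proof.
move=> hU cK ctheta itheta Kg cg z V; rewrite nbhsE => -[W [oW Wgz] WV].
pose L := K `&` ~` W.
have cL : compact L by apply: compact_closedI => //; exact: open_closedC.
have cthL : compact (theta @` L).
  apply: continuous_compact cL.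
  by apply: continuous_subspaceW ctheta => x [].
have nL : open (~` (theta @` L)) by apply: closed_openC; exact: compact_closed.
have : nbhs z ((theta \o g) @^-1` (~` (theta @` L))).
  apply: cg; apply: open_nbhs_nbhs; split => // -[x [Kx nWx]] xz.
  by apply: nWx; rewrite (itheta x (g z)) ?inE.
rewrite nbhs_simpl /=; apply: filterS => y /= nLy; apply: WV.
by apply: contrapT => nWy; apply: nLy; exists (g y).
Qed.

(** * Orbit loops and the van Kampen argument *)

Record torus_action (R : realType) (N : nat) (M : topologicalType)
    (act : cspace R N -> M -> M) : Prop := TorusAction {
  act_one : forall x, act (cone R N) x = x;
  act_mul : forall t s x, torus t -> torus s ->
    act (cmul t s) x = act t (act s x);
  act_within : {within (@torus R N) `*` setT,
    continuous (fun p : cspace R N * M => act p.1 p.2)} }.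

Section OrbitLoops.
Variables (R : realType) (N : nat) (M : topologicalType).
Variable act : cspace R N -> M -> M.
Hypothesis hact : torus_action act.
Implicit Types (x y : M) (u v w : 'rV[int]_N).

Lemma act_continuous (Z : topologicalType) (g : Z -> cspace R N) (f : Z -> M) :
  continuous g -> (forall z, torus (g z)) -> continuous f ->
  continuous (fun z => act (g z) (f z)).
Proof.
move=> cg gT cf.
apply: (within_continuous_comp (act_within hact) (f := fun z => (g z, f z))).
  exact: continuous_pair.
by move=> z; split; first exact: gT.
Qed.

Lemma actV t x : torus t -> act (cconj t) (act t x) = x.
Proof.
move=> tT; rewrite -(act_mul hact) //; last exact: torus_conj.
by rewrite cmulV // (act_one hact).
Qed.

Lemma expT_act_continuous (Z : topologicalType) (phi : Z -> 'rV[R]_N)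
    (f : Z -> M) :
  continuous phi -> continuous f ->
  continuous (fun z => act (expT (phi z)) (f z)).
Proof.
move=> cphi cf; apply: act_continuous => // [|z]; last exact: expT_torus.
exact: (continuous_compf cphi (@expT_continuous _ _)).
Qed.

Lemma orbit_loop_continuous v x :
  continuous (fun t : R => act (expT (t *: rowR R v)) x).
Proof. by apply: expT_act_continuous; cts. Qed.

Lemma orbit_loop_start v x : act (expT ((0 : R) *: rowR R v)) x = x.
Proof. by rewrite scale0r expT0 (act_one hact). Qed.

Lemma orbit_loop_end v x : act (expT ((1 : R) *: rowR R v)) x = x.
Proof. by rewrite scale1r expT_int (act_one hact). Qed.

Definition orbit_loop v x : path R x x :=
  Path (@orbit_loop_continuous v x) (orbit_loop_start v x) (orbit_loop_end v x).

Lemma orbit_loopE v x t : orbit_loop v x t = act (expT (t *: rowR R v)) x.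
Proof. by []. Qed.

Lemma orbit_loop_const v x : (forall t : R, act (expT (t *: rowR R v)) x = x) ->
  orbit_loop v x ≈ pcst R x.
Proof. by move=> vx; apply: homotopic_eqfun => t _; exact: vx. Qed.

Lemma orbit_loop0 x : orbit_loop 0 x ≈ pcst R x.
Proof.
apply: orbit_loop_const => t.
rewrite (_ : rowR R 0 = 0) ?scaler0 ?expT0 ?(act_one hact) //.
by apply/rowP => j; rewrite !mxE.
Qed.

(** The two factors are run through one after the other: in the plane of pairs
    (angle, parameter of the path), this is a staircase homotopic to any curve
    with the same ends. *)
Lemma orbit_loop_twist x y (f g : path R x y) v (phi : R -> 'rV[R]_N) :
  continuous phi -> phi 0 = 0 -> phi 1 = rowR R v ->
  (forall t : R, 0 <= t <= 1 -> f t = act (expT (phi t)) (g t)) ->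
  f ≈ orbit_loop v x ** g.
Proof.
move=> cphi phi0 phi1 fE.
pose G (p : 'rV[R]_N * R) := act (expT p.1) (g p.2).
have cG : continuous G.
  apply: expT_act_continuous; first by cts.
  exact: (continuous_compf (@continuous_snd _ _) (@pcont _ _ _ _ g)).
have [r0 r0'] := @ramp0 R; have [r1 r1'] := @ramp1E R.
have cr1 := @ramp1_continuous R; have cr2 := @ramp2_continuous R.
apply: (@homotopic_line R M _ G (fun t => (phi t, t))
  (fun t => (ramp1 t *: rowR R v, ramp2 t))) => //.
- by cts.
- by cts.
- by rewrite phi0 r0 r0' scale0r.
- by rewrite phi1 r1 r1' scale1r.
- move=> t t01; rewrite pcatE /G /=.
  case: leP => [/ramp_le|/ramp_gt] [-> ->]; first by rewrite path0.
  by rewrite scale1r expT_int (act_one hact).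
Qed.

(** In the square with coordinates (time along the orbit, time along [f]), the
    two sides follow the two halves of the boundary. *)
Lemma orbit_loop_natural x y v (f : path R x y) :
  orbit_loop v x ** f ≈ f ** orbit_loop v y.
Proof.
pose G (p : R * R) := act (expT (p.1 *: rowR R v)) (f p.2).
have cG : continuous G.
  apply: expT_act_continuous; first by cts.
  exact: (continuous_compf (@continuous_snd _ _) (@pcont _ _ _ _ f)).
have [r0 r0'] := @ramp0 R; have [r1 r1'] := @ramp1E R.
have cr1 := @ramp1_continuous R; have cr2 := @ramp2_continuous R.
apply: (@homotopic_line R M _ G (fun t => (ramp1 t, ramp2 t))
  (fun t => (ramp2 t, ramp1 t))) => //.
- by cts.
- by cts.
- by rewrite r0 r0'.
- by rewrite r1 r1'.
- move=> t t01; rewrite pcatE /G /=.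
  case: leP => [/ramp_le|/ramp_gt] [-> ->]; first by rewrite path0.
  by rewrite scale1r expT_int (act_one hact).
- move=> t t01; rewrite pcatE /G /=.
  case: leP => [/ramp_le|/ramp_gt] [-> ->]; last by rewrite path1.
  by rewrite scale0r expT0 (act_one hact).
Qed.

Lemma orbit_loopD u v x : orbit_loop (u + v) x ≈ orbit_loop u x ** orbit_loop v x.
Proof.
apply: (orbit_loop_twist (phi := fun t => t *: rowR R u)).
- by cts.
- by rewrite scale0r.
- by rewrite scale1r.
- move=> t _; rewrite !orbit_loopE rowR_is_additive scalerDr expTD.
  by apply: (act_mul hact); exact: expT_torus.
Qed.

Lemma orbit_loopN v x : orbit_loop (- v) x ** orbit_loop v x ≈ pcst R x.
Proof. by rewrite -orbit_loopD addNr orbit_loop0. Qed.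

(** [orbit_generated K]: up to loops along torus orbits, a path inside K is
    determined by its ends, i.e. pi_1 of an orbit surjects onto that of K, as
    seen from the whole space. *)
Definition orbit_generated (K : set M) := forall x y (f g : path R x y),
  (forall t : R, 0 <= t <= 1 -> K (f t)) ->
  (forall t : R, 0 <= t <= 1 -> K (g t)) -> exists v, f ≈ orbit_loop v x ** g.

Definition path_connected_in (K : set M) := forall x y, K x -> K y ->
  exists f : path R x y, forall t : R, 0 <= t <= 1 -> K (f t).

Lemma pcat_in (K : set M) x y z (f : path R x y) (g : path R y z) :
  (forall t : R, 0 <= t <= 1 -> K (f t)) ->
  (forall t : R, 0 <= t <= 1 -> K (g t)) ->
  forall t : R, 0 <= t <= 1 -> K ((f ** g) t).
Proof.
by move=> Kf Kg t t01; rewrite pcatE; case: ifP => t2; [apply: Kf|apply: Kg]; lra.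
Qed.

Lemma pinv_in (K : set M) x y (f : path R x y) :
  (forall t : R, 0 <= t <= 1 -> K (f t)) ->
  forall t : R, 0 <= t <= 1 -> K (pinv f t).
Proof. by move=> Kf t t01; apply: Kf; lra. Qed.

(** The surjective half of van Kampen's theorem. Every point is joined to a base
    point b of the overlap by a path d staying in each of [K1], [K2] that
    contains the point. Then a short path from x to y is an orbit loop times
    d_x d_y^-1; this form is stable under concatenation, because orbit loops
    commute with paths, so all paths have it, and two paths with the same ends
    differ by an orbit loop. *)
Lemma orbit_generated_union (K1 K2 : set M) :
  open K1 -> open K2 -> path_connected_in K1 -> path_connected_in K2 ->
  path_connected_in (K1 `&` K2) -> K1 `&` K2 !=set0 ->
  orbit_generated K1 -> orbit_generated K2 -> orbit_generated (K1 `|` K2).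
Proof.
move=> oK1 oK2 c1 c2 c12 [b [K1b K2b]] g1 g2.
pose inside K x (d : path R x b) :=
  K x -> forall t : R, 0 <= t <= 1 -> K (d t).
pose ok x (d : path R x b) := inside K1 x d /\ inside K2 x d.
have okex x : (K1 `|` K2) x -> exists d, ok x d.
  have [K1x|nK1x] := pselect (K1 x); have [K2x|nK2x] := pselect (K2 x) => Kx.
  - have [d dK] := c12 x b (conj K1x K2x) (conj K1b K2b).
    by exists d; split=> _ t /dK[].
  - have [d dK] := c1 x b K1x K1b; exists d.
    by split=> [_|/nK2x]; first exact: dK.
  - have [d dK] := c2 x b K2x K2b; exists d.
    by split=> [/nK1x|_]; last exact: dK.
  - by case: Kx.
(* The first two clauses let the middle point of a concatenation be joined to the
   base point. *)
pose S x y (f : path R x y) := [/\ (K1 `|` K2) x, (K1 `|` K2) y &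
  forall dx dy, ok x dx -> ok y dy ->
    exists v, f ≈ orbit_loop v x ** (dx ** pinv dy)].
suff SK x y (f : path R x y) : (forall t : R, 0 <= t <= 1 -> (K1 `|` K2) (f t)) ->
    S x y f.
  move=> x y f g fK gK.
  have [/okex[dx okx] /okex[dy oky] /(_ _ _ okx oky)[v fv]] := SK _ _ _ fK.
  have [_ _ /(_ _ _ okx oky)[w gw]] := SK _ _ _ gK.
  exists (v - w); rewrite fv gw orbit_loopD -!pcatA.
  by rewrite [orbit_loop (- w) x ** _]pcatA orbit_loopN pcat1p.
have Sloc (K : set M) : inside K = inside K1 \/ inside K = inside K2 ->
  K `<=` K1 `|` K2 -> orbit_generated K -> forall x y (f : path R x y),
  (forall t : R, 0 <= t <= 1 -> K (f t)) -> S x y f.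
  move=> insK subK gK {}x {}y {}f fK.
  have insKE z d : ok z d -> inside K z d by case: insK => -> [].
  have Kx : K x by rewrite -(path0 f); apply: fK; lra.
  have Ky : K y by rewrite -(path1 f); apply: fK; lra.
  split; [exact: subK|exact: subK|move=> dx dy okx oky].
  apply: gK => // t t01; apply: pcat_in => // {t01}t t01.
    by apply: (insKE _ _ okx).
  apply: pinv_in => // {t01}t t01.
  by apply: (insKE _ _ oky).
move=> fK; apply: (path_subdivision (S := S)) => [{}x {}y {fK}f g fg [Kx Ky Hf]|
   {}x {}y z {fK}f g [Kx Ky Hf] [_ Kz Hg]|s s01].
- split=> // dx dy okx oky; have [v fv] := Hf _ _ okx oky.
  by exists v; rewrite -fg.
- split=> // dx dz okx okz; have [dy oky] := okex y Ky.
  have [v fv] := Hf _ _ okx oky; have [w gw] := Hg _ _ oky okz.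
  exists (v + w); rewrite fv gw orbit_loopD -!pcatA.
  rewrite [pinv dy ** _]pcatA -orbit_loop_natural -!pcatA.
  rewrite [pinv dy ** (dy ** _)]pcatA pcatVp pcat1p.
  by rewrite [dx ** (orbit_loop _ _ ** _)]pcatA -orbit_loop_natural -!pcatA.
- have [K1f|K2f] := fK s s01.
    exists K1; first exact: open_nbhs_nbhs.
    exact: (Sloc _ (or_introl erefl) (@subsetUl _ _ _) g1).
  exists K2; first exact: open_nbhs_nbhs.
  exact: (Sloc _ (or_intror erefl) (@subsetUr _ _ _) g2).
Qed.

End OrbitLoops.

(** * The lattice killed by the characteristic vectors *)

(** Over Q the rows of lambda generate everything, so the identity matrix is
    C lambda for a rational matrix C; D clears the denominators of C. *)
Lemma rk_full_multiple (N m : nat) (lam : 'I_m -> 'rV[int]_N) :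
  rk lam = N -> exists2 D : nat, (0 < D)%N & forall v : 'rV[int]_N,
    exists c : 'I_m -> int, D%:Z *: v = \sum_i c i *: lam i.
Proof.
rewrite /rk; set B := (\matrix_(_, _) _) => rB.
have [C CB] : exists C, 1%:M = C *m B :> 'M[rat]_N.
  by apply/submxP; rewrite submx_full // /row_full rB.
pose d (p : 'I_N * 'I_m) : int := denq (C p.1 p.2).
pose E : int := \prod_p d p.
have E0 : 0 < E by apply: prodr_gt0 => p _; exact: denq_gt0.
have /choice[c cE] (p : 'I_N * 'I_m) :
    exists n : int, n%:~R = E%:~R * C p.1 p.2 :> rat.
  exists (numq (C p.1 p.2) * \prod_(r | r != p) d r).
  have -> : E = d p * \prod_(r | r != p) d r by rewrite /E (bigD1 p).
  by rewrite !rmorphM /= numqE /d; ring.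
exists `|E|%N; first by rewrite absz_gt0 gt_eqF.
move=> v; exists (fun i => \sum_j v 0 j * c (j, i)).
rewrite gez0_abs ?ltW //; apply/rowP => k; rewrite mxE summxE.
apply: (@intr_inj rat); rewrite intrM rmorph_sum /=.
have -> : (v 0 k)%:~R = \sum_j (v 0 j)%:~R * (1%:M : 'M[rat]_N) j k.
  rewrite (bigD1 k) //= mxE eqxx mulr1 big1 ?addr0 // => j jk.
  by rewrite mxE (negbTE jk) mulr0.
rewrite CB mulr_sumr.
transitivity (\sum_j \sum_i E%:~R * ((v 0 j)%:~R * (C j i * B i k))).
  by apply: eq_bigr => j _; rewrite mxE !mulr_sumr.
rewrite exchange_big /=; apply: eq_bigr => i _.
rewrite [in RHS]mxE intrM rmorph_sum mulr_suml; apply: eq_bigr => j _.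
by rewrite rmorphM /= (cE (j, i)) /= /B mxE; ring.
Qed.

Section FiniteQuotient.
Variables (R : realType) (N m : nat) (M : topologicalType).
Variable act : cspace R N -> M -> M.
Hypothesis hact : torus_action act.
Variable x0 : M.
Local Notation orbit_loop v := (orbit_loop hact v x0).

Lemma orbit_loop_sum_trivial (lam : 'I_m -> 'rV[int]_N) (c : 'I_m -> int) :
  (forall i, orbit_loop (lam i) ≈ pcst R x0) ->
  orbit_loop (\sum_i c i *: lam i) ≈ pcst R x0.
Proof.
move=> lam0; pose P v := orbit_loop v ≈ pcst R x0.
have PD u v : P u -> P v -> P (u + v).
  by rewrite /P orbit_loopD => -> ->; rewrite pcat1p.
have PN u : P u -> P (- u).
  by rewrite /P => u0; rewrite -[orbit_loop (- u)]pcatp1 -{1}u0 orbit_loopN.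
have P0 : P 0 by exact: orbit_loop0.
have Pn u n : P u -> P (n%:Z *: u).
  move=> Pu; elim: n => [|n IHn]; first by rewrite scale0r.
  by rewrite intS scalerDl scale1r; exact: PD.
apply: (big_ind P) => // i _; case: (c i) => n; first exact/Pn/lam0.
by rewrite NegzE scaleNr; exact/PN/Pn/lam0.
Qed.

(** Orbit loops only depend on the residues of their coordinates modulo D, since
    D Z^N is contained in the lattice generated by the trivial loops. *)
Lemma finite_abelian_of_orbit_loops (lam : 'I_m -> 'rV[int]_N) :
  (forall f : path R x0 x0, exists v, f ≈ orbit_loop v) ->
  (forall i, orbit_loop (lam i) ≈ pcst R x0) -> rk lam = N ->
  finite_abelian_group (pi1 R x0) (pi1_mul x0) (pi1_one R x0).
Proof.
move=> gen lam0 /rk_full_multiple[D D0 mulD].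
pose F (i : {ffun 'I_N -> 'I_D}) := orbit_loop (\row_j (i j : nat)%:Z).
apply: (pi1_finite_abelian (F := F)) => [p q|p].
  have [u ->] := gen p; have [v ->] := gen q.
  by rewrite -!orbit_loopD addrC.
have [v pv] := gen p.
pose r j := absz (modz (v 0 j) D%:Z).
have rE j : (r j)%:Z = modz (v 0 j) D%:Z.
  by rewrite /r gez0_abs // modz_ge0 // gt_eqF.
have rlt j : (r j < D)%N.
  by rewrite -ltz_nat rE ltz_pmod.
exists [ffun j => Ordinal (rlt j)]; rewrite pv {pv}/F.
pose w : 'rV[int]_N := \row_j divz (v 0 j) D%:Z.
have [c Dw] := mulD w.
set v' := (X in _ ≈ orbit_loop X).
have -> : v = v' + D%:Z *: w.
  apply/rowP => j; rewrite !mxE ffunE /= rE.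
  by rewrite {1}(divz_eq (v 0 j) D); ring.
by rewrite orbit_loopD Dw (orbit_loop_sum_trivial _ lam0) pcatp1.
Qed.

End FiniteQuotient.

(** * Polar coordinates and standard charts *)

Section Polar.
Variables (R : realType) (N : nat).
Implicit Types (z w t : cspace R N) (j : 'I_N).

Definition modulus z j : R := Num.sqrt (z.1 0 j ^+ 2 + z.2 0 j ^+ 2).

Lemma modulus_ge0 z j : 0 <= modulus z j. Proof. exact: sqrtr_ge0. Qed.

Lemma modulus_sq z j : modulus z j ^+ 2 = z.1 0 j ^+ 2 + z.2 0 j ^+ 2.
Proof. by rewrite sqr_sqrtr // addr_ge0 ?sqr_ge0. Qed.

Lemma modulus_eq z j (a : R) : 0 <= a -> z.1 0 j ^+ 2 + z.2 0 j ^+ 2 = a ^+ 2 ->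
  modulus z j = a.
Proof. by move=> a0 za; rewrite /modulus za sqrtr_sqr ger0_norm. Qed.

Lemma torus_modulP t : torus t <-> forall j, modulus t j = 1.
Proof.
split=> [/torusP tt j|tt]; first by rewrite /modulus tt sqrtr1.
by apply/torusP => j; rewrite -modulus_sq tt expr1n.
Qed.

Lemma modulus_mul z w j : modulus (cmul z w) j = modulus z j * modulus w j.
Proof.
apply: modulus_eq; first by rewrite mulr_ge0 ?modulus_ge0.
by rewrite exprMn !modulus_sq !cmulE; ring.
Qed.

Lemma modulus_torus_mul t z j : torus t -> modulus (cmul t z) j = modulus z j.
Proof. by move=> /torus_modulP tt; rewrite modulus_mul tt mul1r. Qed.

Lemma modulus_continuous j : continuous (fun z => modulus z j).
Proof.
apply: (@continuous_compf _ _ _ (fun z => z.1 0 j ^+ 2 + z.2 0 j ^+ 2));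
  last exact: sqrt_continuous.
have c1 : continuous (fun z : cspace R N => z.1 0 j).
  by apply: continuous_coord; cts.
have c2 : continuous (fun z : cspace R N => z.2 0 j).
  by apply: continuous_coord; cts.
by apply: continuous_addf; apply: continuous_mulf.
Qed.

Definition phase_re z j : R := if modulus z j == 0 then 1 else z.1 0 j / modulus z j.
Definition phase_im z j : R := if modulus z j == 0 then 0 else z.2 0 j / modulus z j.

(** The phases z_j / |z_j|; the value 1 at 0 keeps them in the torus. *)
Definition phase z : cspace R N := (\row_j phase_re z j, \row_j phase_im z j).

Lemma phaseK z j :
  z.1 0 j = modulus z j * phase_re z j /\ z.2 0 j = modulus z j * phase_im z j.
Proof.
rewrite /phase_re /phase_im; case: eqP => [m0|/eqP m0]; last first.
  by rewrite !mulrA ![modulus z j * _]mulrC !mulfK.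
have : modulus z j ^+ 2 = 0 by rewrite m0 expr0n.
rewrite modulus_sq m0 mul0r => /eqP; rewrite paddr_eq0 ?sqr_ge0 // !sqrf_eq0.
by move=> /andP[/eqP -> /eqP ->]; rewrite mulr0.
Qed.

Lemma phase_sq z j : phase_re z j ^+ 2 + phase_im z j ^+ 2 = 1.
Proof.
rewrite /phase_re /phase_im; case: eqP => [_|/eqP m0]; first by ring.
by rewrite !exprMn -mulrDl -modulus_sq -exprMn mulfV // expr1n.
Qed.

Lemma phase_torus z : torus (phase z).
Proof. by apply/torusP => j; rewrite !mxE phase_sq. Qed.

Lemma cspace_ball z w (e : R) : 0 < e ->
  (forall j, `|z.1 0 j - w.1 0 j| < e /\ `|z.2 0 j - w.2 0 j| < e) ->
  ball z e w.
Proof. by move=> e0 zw; split; split=> // i j; rewrite (ord1 i); case: (zw j). Qed.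

(** Turning each coordinate of z to the phase of that of [z0] leaves the distance
    between the moduli as the only distance to [z0]. In particular an invariant
    open set contains all points with nearly the same moduli as [z0]. *)
Lemma rotate_near (W : set (cspace R N)) z0 : open W -> W z0 ->
  exists2 e : R, 0 < e & forall z, (forall j, `|modulus z j - modulus z0 j| < e) ->
    exists2 t, torus t & W (cmul t z).
Proof.
move=> oW Wz0; have /nbhs_ballP[e /= e0 eW] : nbhs z0 W by exact: open_nbhs_nbhs.
exists e => // z zz0; exists (cmul (phase z0) (cconj (phase z))).
  by apply: torus_mul; [exact: phase_torus|exact/torus_conj/phase_torus].
apply: eW; apply: cspace_ball => // j.
have norm_le1 (d d' : R) : d ^+ 2 + d' ^+ 2 = 1 -> `|d| <= 1.
  by move=> dd; rewrite ler_norml; apply/andP; split; nra.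
have d1 : `|phase_re z0 j| <= 1 by exact: norm_le1 (phase_sq z0 j).
have d2 : `|phase_im z0 j| <= 1 by apply: norm_le1; rewrite addrC; exact: phase_sq.
have [z1 z2] := phaseK z j; have [z01 z02] := phaseK z0 j.
have small (d : R) : `|d| <= 1 -> `|(modulus z0 j - modulus z j) * d| < e.
  move=> d0; rewrite normrM distrC; apply: le_lt_trans (zz0 j).
  by rewrite ler_piMr.
rewrite !cmulE !mxE /= z1 z2 z01 z02; have := phase_sq z j => dz; split.
- rewrite (_ : _ - _ = (modulus z0 j - modulus z j) * phase_re z0 j); first exact: small.
  by rewrite [RHS]mulrBl -[modulus z j * phase_re _ _ in RHS]mulr1 -dz; ring.
- rewrite (_ : _ - _ = (modulus z0 j - modulus z j) * phase_im z0 j); first exact: small.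
  by rewrite [RHS]mulrBl -[modulus z j * phase_im _ _ in RHS]mulr1 -dz; ring.
Qed.

End Polar.

Lemma convex_lt (R : realType) (x y c a : R) :
  0 <= a <= 1 -> x < c -> y < c -> (1 - a) * x + a * y < c.
Proof.
move=> a01 xc yc; have [xy|yx] := leP x y.
  by apply: (@le_lt_trans _ _ y) => //; nra.
by apply: (@le_lt_trans _ _ x) => //; nra.
Qed.

Section StandardChart.
Variables (R : realType) (n k : nat) (M : topologicalType) (d : nat).
Variables (A : set (chart R M d)) (act : cspace R (n + k) -> M -> M).
Hypothesis hact : torus_action act.
Variable s : std_chart R n k M.
Hypothesis hs : is_std_chart A act s.
Local Notation C := (cspace R (n + k)).

Lemma std_spaceP (z : C) :
  std_space z <-> forall j, modulus z (rshift n j) = 1.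
Proof.
split=> [h j|h j].
  by have /ccoord_norm_eq1 := h j; rewrite /modulus => ->; rewrite sqrtr1.
by apply/ccoord_norm_eq1; rewrite -modulus_sq h expr1n.
Qed.

Variables (z0 : C) (e : R).
Hypothesis e0 : 0 < e.

(** The part of C^n x T^k where the moduli are close to those of [z0]: a
    product of discs, annuli and circles. *)
Definition moduli_nbhs : set C :=
  [set z | std_space z /\ forall j, `|modulus z j - modulus z0 j| < e].

Lemma moduli_nbhs_mul t z :
  torus t -> moduli_nbhs z -> moduli_nbhs (cmul t z).
Proof.
move=> tt [/std_spaceP zs ze]; split.
  by apply/std_spaceP => j; rewrite modulus_torus_mul.
by move=> j; rewrite modulus_torus_mul.
Qed.

Hypothesis z0s : std_space z0.
Hypothesis sub_simg : moduli_nbhs `<=` simg s.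
Hypothesis e_small : forall j, modulus z0 j != 0 -> e <= modulus z0 j.

Definition chart_nbhs : set M :=
  [set y | sdom s y /\ moduli_nbhs (smap s y)].

Lemma sdom_std y : sdom s y -> std_space (smap s y).
Proof. by case: hs => _ [ss _] _ _ _ sy; apply: ss; exists y. Qed.

Lemma chart_nbhs_open : open chart_nbhs.
Proof.
case: hs => -[sdo _] _ [_ [/subspace_continuousP cs _]] _ _.
rewrite openE => y [sy [_ ye]].
have cm j : \forall x \near y, sdom s x -> `|modulus (smap s x) j - modulus z0 j| < e.
  have : nbhs (smap s y) [set z | `|modulus z j - modulus z0 j| < e].
    have cg : continuous (fun z : C => `|modulus z j - modulus z0 j|).
      move=> z; apply: (@continuous_comp _ _ _ (fun z : C => modulus z j - modulus z0 j)).
        by move: z; apply: continuous_addf; [exact: modulus_continuous|cts].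
      exact: norm_continuous.
    exact: (cvgr_lt _ (cg _) _ (ye j)).
  exact: (cs y sy).
have sn : \forall x \near y, sdom s x by exact: open_nbhs_nbhs.
have xe : \forall x \near y, forall j,
    sdom s x -> `|modulus (smap s x) j - modulus z0 j| < e by exact: filter_forall.
apply: filterS2 sn xe => x sx xe.
by split=> //; split; [exact: sdom_std|move=> j; exact: xe].
Qed.

Lemma chart_nbhs_act t y : torus t -> chart_nbhs y -> chart_nbhs (act t y).
Proof.
case: hs => -[_ sinv] _ _ _ [[[thT _ _] _ _] eqv] tt [sy ye].
split; first exact: sinv.
by rewrite eqv //; apply: moduli_nbhs_mul => //; exact: thT.
Qed.

Lemma torus_aut_cone : saut s (cone R (n + k)) = cone R (n + k).
Proof.
case: hs => _ _ _ _ [[[thT _ _] _ thM] _].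
have T1 := @cone_torus R (n + k).
have := thM _ _ T1 T1; rewrite cmul1 => /(congr1 (cmul (cconj (saut s (cone R _))))).
by rewrite cmulA cmulV ?cmul1 //; exact: thT.
Qed.

(** The rotation taking the phases of [w] to those of [z], in the coordinates
    where moduli stay away from 0. In the other coordinates, which range over
    discs, no rotation is made: phases would not be continuous there. *)
Definition phase_diff (z w : C) : C :=
  (\row_j (if modulus z0 j == 0 then 1 else (cmul (phase z) (cconj (phase w))).1 0 j),
   \row_j (if modulus z0 j == 0 then 0 else (cmul (phase z) (cconj (phase w))).2 0 j)).

Lemma phase_diff_torus z w : torus (phase_diff z w).
Proof.
apply/torusP => j; rewrite !mxE /=; case: eqP => _; first by ring.
have /torusP := torus_mul (phase_torus z) (torus_conj (phase_torus w)).
by move=> /(_ j); rewrite !cmulE !mxE.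
Qed.

Lemma phase_diff_refl z : phase_diff z z = cone R (n + k).
Proof.
apply: cspaceP => j; rewrite !mxE /=; case: eqP => // _.
rewrite !mxE; split; last by ring.
transitivity (phase_re z j ^+ 2 + phase_im z j ^+ 2); [by ring|exact: phase_sq].
Qed.

Lemma moduli_nbhs_modulus_gt0 z j :
  moduli_nbhs z -> modulus z0 j != 0 -> 0 < modulus z j.
Proof.
move=> [_ /(_ j) ze] /e_small em; move: ze; rewrite ltr_norml => /andP[? _]; lra.
Qed.

Lemma phase_diff_continuous (F G : R -> C) : continuous F -> continuous G ->
  (forall t, moduli_nbhs (F t)) -> (forall t, moduli_nbhs (G t)) ->
  continuous (fun t => phase_diff (F t) (G t)).
Proof.
move=> cF cG VF VG.
have cphase (H : R -> C) j : modulus z0 j != 0 -> continuous H ->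
    (forall t, moduli_nbhs (H t)) ->
    continuous (fun t => phase_re (H t) j) /\ continuous (fun t => phase_im (H t) j).
  move=> m0 cH VH.
  have mH t : modulus (H t) j != 0.
    by rewrite gt_eqF // (moduli_nbhs_modulus_gt0 (VH t) m0).
  have cmi : continuous (fun t => (modulus (H t) j)^-1).
    by move=> t; apply: cvgV => //; exact: (continuous_compf cH (@modulus_continuous _ _ j)).
  have c1 : continuous (fun t => (H t).1 0 j).
    by apply: continuous_coord; exact: (continuous_compf cH (@continuous_fst _ _)).
  have c2 : continuous (fun t => (H t).2 0 j).
    by apply: continuous_coord; exact: (continuous_compf cH (@continuous_snd _ _)).
  split.
  - rewrite (_ : (fun _ => _) = fun t => (H t).1 0 j * (modulus (H t) j)^-1); first by cts.
    by apply/funext => t; rewrite /phase_re (negbTE (mH t)).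
  - rewrite (_ : (fun _ => _) = fun t => (H t).2 0 j * (modulus (H t) j)^-1); first by cts.
    by apply/funext => t; rewrite /phase_im (negbTE (mH t)).
apply: continuous_pair; apply: continuous_row => j.
- have [m0|m0] := eqVneq (modulus z0 j) 0.
    rewrite (_ : (fun _ => _) = fun=> 1); first by cts.
    by apply/funext => t; rewrite mxE m0 eqxx.
  have [c1 c2] := cphase F j m0 cF VF; have [c3 c4] := cphase G j m0 cG VG.
  rewrite (_ : (fun _ => _) = fun t => phase_re (F t) j * phase_re (G t) j
    + phase_im (F t) j * phase_im (G t) j); first by cts.
  by apply/funext => t; rewrite mxE (negbTE m0) cmulE !mxE /=; ring.
- have [m0|m0] := eqVneq (modulus z0 j) 0.
    rewrite (_ : (fun _ => _) = fun=> 0); first by cts.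
    by apply/funext => t; rewrite mxE m0 eqxx.
  have [c1 c2] := cphase F j m0 cF VF; have [c3 c4] := cphase G j m0 cG VG.
  rewrite (_ : (fun _ => _) = fun t => - (phase_re (F t) j * phase_im (G t) j)
    + phase_im (F t) j * phase_re (G t) j); first by cts.
  by apply/funext => t; rewrite mxE (negbTE m0) cmulE !mxE /=; ring.
Qed.

(** After the rotation, corresponding coordinates lie on the same ray, along which
    the modulus is affine, or in the same disc, which is convex. *)
Lemma phase_diff_segment z w (a : R) : moduli_nbhs z -> moduli_nbhs w ->
  0 <= a <= 1 ->
  moduli_nbhs ((1 - a) *: z + a *: cmul (phase_diff z w) w).
Proof.
move=> Vz Vw a01; set y := (_ + _).
have y1 j : y.1 0 j = (1 - a) * z.1 0 j + a * (cmul (phase_diff z w) w).1 0 j.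
  by rewrite !mxE.
have y2 j : y.2 0 j = (1 - a) * z.2 0 j + a * (cmul (phase_diff z w) w).2 0 j.
  by rewrite !mxE.
have ray j : modulus z0 j != 0 -> modulus y j = (1 - a) * modulus z j + a * modulus w j.
  move=> m0; have mz := modulus_ge0 z j; have mw := modulus_ge0 w j.
  apply: modulus_eq; first by rewrite addr_ge0 // mulr_ge0 //; lra.
  rewrite y1 y2 !cmulE !mxE /= (negbTE m0) !mxE.
  have [z1 z2] := phaseK z j; have [w1 w2] := phaseK w j.
  rewrite z1 z2 w1 w2; have dz := phase_sq z j; have dw := phase_sq w j.
  move: (phase_re z j) (phase_im z j) (phase_re w j) (phase_im w j) dz dw => p q r u dz dw.
  transitivity (((1 - a) * modulus z j + a * modulus w j * (r ^+ 2 + u ^+ 2)) ^+ 2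
    * (p ^+ 2 + q ^+ 2)); first by ring.
  by rewrite dw dz !mulr1.
have [/std_spaceP zs ze] := Vz; have [/std_spaceP ws we] := Vw.
split.
  apply/std_spaceP => j; rewrite ray ?zs ?ws; first by ring.
  by have /std_spaceP -> := z0s; rewrite oner_eq0.
move=> j; have [m0|m0] := eqVneq (modulus z0 j) 0; last first.
  rewrite ray //; move: (ze j) (we j); rewrite !ltr_norml.
  move=> /andP[z1 z2] /andP[w1 w2].
  have lo : (1 - a) * (modulus z0 j - modulus z j)
      + a * (modulus z0 j - modulus w j) < e.
    by apply: convex_lt => //; lra.
  have hi : (1 - a) * (modulus z j - modulus z0 j)
      + a * (modulus w j - modulus z0 j) < e.
    by apply: convex_lt => //; lra.
  by apply/andP; split; lra.
move: (ze j) (we j); rewrite m0 !subr0 !ger0_norm ?modulus_ge0 // => zj wj.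
have sq (v : C) : (modulus v j < e) = (v.1 0 j ^+ 2 + v.2 0 j ^+ 2 < e ^+ 2).
  by rewrite -modulus_sq ltr_pXn2r // nnegrE ?modulus_ge0 // ltW.
move: zj wj; rewrite !sq y1 y2 !cmulE !mxE /= m0 eqxx.
move: (z.1 0 j) (z.2 0 j) (w.1 0 j) (w.2 0 j) => p q r u pq ru.
apply: (@le_lt_trans _ _ ((1 - a) * (p ^+ 2 + q ^+ 2) + a * (r ^+ 2 + u ^+ 2))).
  rewrite -subr_ge0.
  rewrite (_ : _ - _ = a * (1 - a) * ((p - r) ^+ 2 + (q - u) ^+ 2)); last by ring.
  have a1 : 0 <= 1 - a by lra.
  by rewrite mulr_ge0 ?addr_ge0 ?sqr_ge0 // mulr_ge0 //; case/andP: a01.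
exact: convex_lt.
Qed.

(** In the chart, f is homotopic to g rotated by the phase differences. These form
    a loop gam of the torus at 1, because f and g have the same ends. The
    automorphism of the chart is a homeomorphism of the compact torus, so gam is
    the image of a loop gam' that acts on M; gam' lifts to a curve phi of R^N
    whose end is an integer vector, the class of the orbit loop. *)
Lemma chart_nbhs_orbit_generated : orbit_generated hact chart_nbhs.
Proof.
move=> x y f g fV gV.
case: hs => -[_ sinvt] _ [sK [csmap csinv]] _ [[[thT thI thS] thc thM] eqv].
have c01 (t : R) : 0 <= clamp t <= 1 by rewrite clamp_ge0 clamp_le1.
have lift (h : path R x y) : (forall t : R, 0 <= t <= 1 -> chart_nbhs (h t)) ->
    continuous (fun t => smap s (h (clamp t))).
  move=> hV; apply: (within_continuous_comp csmap (f := fun t => h (clamp t))).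
    exact: (continuous_compf (@clamp_continuous R) (@pcont _ _ _ _ h)).
  by move=> t; case: (hV _ (c01 t)).
pose F t := smap s (f (clamp t)); pose G t := smap s (g (clamp t)).
have cF : continuous F by exact: lift.
have cG : continuous G by exact: lift.
have VF t : moduli_nbhs (F t) by case: (fV _ (c01 t)).
have VG t : moduli_nbhs (G t) by case: (gV _ (c01 t)).
have FG0 : F 0 = G 0 by rewrite /F /G !clamp0 !path0.
have FG1 : F 1 = G 1 by rewrite /F /G !clamp1 !path1.
pose gam t := phase_diff (F t) (G t).
have cgam : continuous gam by exact: phase_diff_continuous.
have /choice[gam' gamE] t : exists u, torus u /\ saut s u = gam t.
  by have [u tu ue] := thS _ (phase_diff_torus (F t) (G t)); exists u.
have thinj t u : torus t -> torus u -> saut s t = saut s u -> t = u.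
  by move=> tt tu; apply: thI; rewrite inE.
have cgam' : continuous gam'.
  apply: (continuous_factor_compact _ (@torus_compact _ _) thc) => //.
  - by move=> t; case: (gamE t).
  - rewrite (_ : _ \o _ = gam) //; apply/funext => t; exact: (gamE t).2.
have gamcone t : F t = G t -> gam' t = cone R (n + k).
  move=> FGt; apply: thinj; [exact: (gamE t).1|exact: cone_torus|].
  by rewrite torus_aut_cone (gamE t).2 /gam FGt phase_diff_refl.
have [phi [cphi phi0 phiE]] := expT_lift cgam' (fun t => (gamE t).1) (gamcone _ FG0).
have [v phi1] : exists v : 'rV[int]_(n + k), phi 1 = rowR R v.
  by apply: expT_eq1; rewrite -phiE ?gamcone //; lra.
have ch : continuous (fun t => act (expT (phi t)) (g t)).
  by apply: expT_act_continuous => //; exact: pcont.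
have h0 : act (expT (phi 0)) (g 0) = x by rewrite phi0 expT0 (act_one hact) path0.
have h1 : act (expT (phi 1)) (g 1) = y.
  by rewrite phi1 expT_int (act_one hact) path1.
exists v; rewrite -(orbit_loop_twist hact (f := Path ch h0 h1) cphi phi0 phi1) //.
apply: (@homotopic_segment R M C moduli_nbhs (sinv s) F
  (fun t => cmul (gam t) (G t))) => //.
- exact: continuous_subspaceW csinv.
- exact: cmul_continuous.
- by move=> a t a01 t01; apply: phase_diff_segment.
- by rewrite /gam FG0 phase_diff_refl cmul1.
- by rewrite /gam FG1 phase_diff_refl cmul1.
- move=> t t01; rewrite /F clampE // sK //; by case: (fV _ t01).
- move=> t t01 /=; rewrite -phiE // /G clampE // -(gamE t).2 -eqv.
  + rewrite sK //; apply: sinvt; first exact: (gamE t).1.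
    by case: (gV _ t01).
  + exact: (gamE t).1.
  + by case: (gV _ t01).
Qed.

End StandardChart.

(** * Small invariant neighborhoods, small paths *)

(** The image of a standard chart is only known to be invariant and relatively
    open, but such a set contains a neighborhood given by conditions on the
    moduli. *)
Lemma std_chart_nbhs (R : realType) (n k : nat) (M : topologicalType) (d : nat)
    (A : set (chart R M d)) (act : cspace R (n + k) -> M -> M)
    (hact : torus_action act) (s : std_chart R n k M) (x : M) :
  is_std_chart A act s -> sdom s x ->
  exists V : set M, [/\ open V, V x,
    forall t y, torus t -> V y -> V (act t y) & orbit_generated hact V].
Proof.
move=> hs sx; have xs := sdom_std hs sx; pose z0 := smap s x.
have [_ [_ [[W oW sW] simgT]] _ _ _] := hs.
have Wz0 : W z0 by have : simg s z0 by [exists x]; rewrite sW => -[].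
have [e1 e1_gt0 rot] := rotate_near oW Wz0.
have : \forall e \near 0^'+, [/\ 0 < e, e <= e1 &
    forall j, modulus z0 j != 0 -> e <= modulus z0 j].
  have e_small : \forall e \near 0^'+, forall j, modulus z0 j != 0 -> e <= modulus z0 j.
    apply: filter_forall => j; have [->|m0] := eqVneq (modulus z0 j) 0.
      by near=> e.
    near=> e => _; near: e; apply: nbhs_right_le.
    by rewrite lt_neqAle eq_sym m0 modulus_ge0.
  near=> e; split; [|near: e; exact: nbhs_right_le|by near: e].
  by near: e; exact: nbhs_right_gt.
move=> /filter_ex[e [e0 ee1 e_small]].
have sub_simg : moduli_nbhs z0 e `<=` simg s.
  move=> z [zs ze]; have [|t tt Wtz] := rot z.
    by move=> j; apply: lt_le_trans ee1; exact: ze.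
  rewrite -[z]cmul1 -(cmulV tt) -cmulA; apply: simgT; first exact: torus_conj.
  rewrite sW; split => //; apply/std_spaceP => j; rewrite modulus_torus_mul //.
  by move: j; exact/std_spaceP.
exists (chart_nbhs s z0 e); split.
- exact: (chart_nbhs_open hs).
- by split => //; split => // j; rewrite subrr normr0.
- by move=> t y tt Vy; exact: (chart_nbhs_act hs).
- exact: (chart_nbhs_orbit_generated hact hs e0 xs sub_simg e_small).
Unshelve. all: by end_near. Qed.

Section LocallyPathConnected.
Variables (R : realType) (M : topologicalType).

Definition locally_path_connected := forall (U : set M) x, open U -> U x ->
  exists V : set M, [/\ open V, V x & forall y, V y ->
    exists f : path R x y, forall t : R, 0 <= t <= 1 -> U (f t)].

(** Radial segments in a ball of a chart of the manifold. *)
Lemma chart_locally_path_connected (d : nat) (A : set (chart R M d)) :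
  (forall c, A c -> is_chart c) ->
  (forall x, exists2 c, A c & cdom c x) -> locally_path_connected.
Proof.
move=> Ac Acov U x oU Ux; have [c /Ac[od oimg cmapc cinvc cK] cx] := Acov x.
pose u0 := cmap c x; pose S := [set u | (cmap c @` cdom c) u /\ U (cinv c u)].
have imgu0 : (cmap c @` cdom c) u0 by exists x.
have [e /= e0 eS] : exists2 e : R, 0 < e & ball u0 e `<=` S.
  apply/nbhs_ballP; have /subspace_continuousP/(_ _ imgu0) cu0 := cinvc.
  have : nbhs (cinv c u0) U by apply: open_nbhs_nbhs; rewrite /u0 cK.
  move=> /cu0; rewrite nbhs_simpl /= /within /=.
  have : nbhs u0 (cmap c @` cdom c) by exact: open_nbhs_nbhs.
  by apply: filterS2 => u iu Uu; split => //; exact: Uu.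
pose V := [set y | cdom c y /\ ball u0 e (cmap c y)].
have VV : nbhs x V.
  have /subspace_continuousP/(_ _ cx) cmx := cmapc.
  have : nbhs (cmap c x) (ball u0 e) by exact: nbhsx_ballx.
  move=> /cmx; rewrite nbhs_simpl /= /within /=.
  have : nbhs x (cdom c) by exact: open_nbhs_nbhs.
  by apply: filterS2 => y dy By; split => //; exact: By.
exists V°; split; [exact: open_interior|exact: VV|].
move=> y /interior_subset[dy By].
pose c1 t := (1 - clamp t) *: u0 + clamp t *: cmap c y.
have Sc1 t : S (c1 t).
  apply: eS; have t0 := clamp_ge0 t; have t1 := clamp_le1 t.
  rewrite -ball_normE /=.
  rewrite (_ : u0 - c1 t = clamp t *: (u0 - cmap c y)); last first.
    by rewrite /c1 scalerBr scalerBl scale1r opprD opprB addrA subrKC.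
  rewrite normrZ ger0_norm //; apply: (@le_lt_trans _ _ `|u0 - cmap c y|).
    by rewrite ler_piMl.
  by move: By; rewrite -ball_normE.
have cc1 : continuous c1 by have cc := @clamp_continuous R; rewrite /c1; cts.
have cf : continuous (fun t => cinv c (c1 t)).
  by apply: (within_continuous_comp cinvc cc1) => t; case: (Sc1 t).
have f0 : cinv c (c1 0) = x.
  by rewrite /c1 clamp0 subr0 scale1r scale0r addr0 cK.
have f1 : cinv c (c1 1) = y.
  by rewrite /c1 clamp1 subrr scale1r scale0r add0r cK.
by exists (Path cf f0 f1) => t _; case: (Sc1 t).
Qed.

End LocallyPathConnected.

(** * Path connectedness over the orbit space *)

Section ConvexSets.
Variables (R : realType) (E : normedModType R).

Definition segm (p p' : E) (s : R) : E := (1 - s) *: p + s *: p'.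

Definition convex_in (K : set E) := forall p p' (s : R), K p -> K p' ->
  0 <= s <= 1 -> K (segm p p' s).

Lemma segm0 p p' : segm p p' 0 = p.
Proof. by rewrite /segm subr0 scale1r scale0r addr0. Qed.

Lemma segm1 p p' : segm p p' 1 = p'.
Proof. by rewrite /segm subrr scale0r scale1r add0r. Qed.

Lemma segm_continuous p p' : continuous (segm p p').
Proof. by rewrite /segm; cts. Qed.

Lemma convex_inI (K L : set E) : convex_in K -> convex_in L -> convex_in (K `&` L).
Proof. by move=> cK cL p p' s [? ?] [? ?] s01; split; [exact: cK|exact: cL]. Qed.

End ConvexSets.

Section OrbitSpace.
Variables (R : realType) (N : nat) (M : topologicalType) (E : normedModType R).
Variable act : cspace R N -> M -> M.
Hypothesis hact : torus_action act.
Variables (P : set E) (q : M -> E).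
Hypothesis q_continuous : continuous q.
Hypothesis q_range : range q = P.
Hypothesis q_fiber : forall x y, q x = q y <-> exists2 t, torus t & y = act t x.
Hypothesis q_quotient : forall V : set E, open (q @^-1` V) ->
  exists2 W : set E, open W & V `&` P = W `&` P.
Hypothesis M_lpc : locally_path_connected R M.
Hypothesis P_convex : convex_in P.

Lemma q_in x : P (q x). Proof. by rewrite -q_range; exists x. Qed.

Lemma q_lift p : P p -> exists x, q x = p.
Proof. by rewrite -q_range => -[x _ <-]; exists x. Qed.

Lemma q_act t x : torus t -> q (act t x) = q x.
Proof. by move=> tt; apply/esym/q_fiber; exists t. Qed.

Lemma act_slice_continuous t : torus t -> continuous (act t).
Proof. by move=> tt; apply: (act_continuous hact (f := id)) => //; cts. Qed.

(** An invariant set is a union of fibers of [q], which is a quotient map. *)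
Lemma saturated_open (V : set M) : open V ->
  (forall t y, torus t -> V y -> V (act t y)) ->
  exists2 W : set E, open W & forall y, V y <-> W (q y).
Proof.
move=> oV Vact; have VE : q @^-1` (q @` V) = V.
  apply/seteqP; split=> [y [x Vx] /q_fiber[t tt ->]|y Vy]; first exact: Vact.
  by exists y.
have [|W oW eW] := q_quotient (V := q @` V); first by rewrite VE.
exists W => // y; rewrite -[V in V y]VE /=.
have := eW => /seteqP[h1 h2]; split=> hy.
  by case: (h1 (q y)) => //; split => //; exact: q_in.
by case: (h2 (q y)) => //; split => //; exact: q_in.
Qed.

Lemma fiber_path x y : q x = q y -> exists f : path R x y, forall t : R, q (f t) = q x.
Proof.
move=> /q_fiber[t tt ->]; have [w <-] := expT_surj tt.
have cf : continuous (fun r : R => act (expT (r *: w)) x).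
  by apply: (expT_act_continuous hact); cts.
have f0 : act (expT ((0 : R) *: w)) x = x by rewrite scale0r expT0 (act_one hact).
have f1 : act (expT ((1 : R) *: w)) x = act (expT w) x by rewrite scale1r.
by exists (Path cf f0 f1) => r /=; rewrite q_act //; exact: expT_torus.
Qed.

(** The segment between the images is followed in M by short steps. The union of
    the orbits meeting a small neighborhood of a point z is the preimage of an
    open set; so if p is close to the image of z, then every point above p is
    joined to z by a path along its orbit and then a short path. *)
Lemma preimage_path_connected (K : set E) :
  open K -> convex_in K -> path_connected_in R (q @^-1` K).
Proof.
move=> oK cK x y Kx Ky; pose c := segm (q x) (q y).
have Kc s : 0 <= s <= 1 -> K (c s) by exact: cK.
have Pc s : 0 <= s <= 1 -> P (c s) by apply: P_convex; exact: q_in.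
pose C (s s' : R) := forall z z', q z = c s -> q z' = c s' ->
  exists f : path R z z', forall t : R, 0 <= t <= 1 -> K (q (f t)).
suff : C 0 1 by apply; rewrite /c ?segm0 ?segm1.
have trans z1 z2 z3 :
    (exists f : path R z1 z2, forall t : R, 0 <= t <= 1 -> K (q (f t))) ->
    (exists f : path R z2 z3, forall t : R, 0 <= t <= 1 -> K (q (f t))) ->
    exists f : path R z1 z3, forall t : R, 0 <= t <= 1 -> K (q (f t)).
  move=> [f fK] [g gK]; exists (f ** g).
  exact: (pcat_in (K := q @^-1` K)).
have fib z1 z2 : q z1 = q z2 -> K (q z1) ->
    exists f : path R z1 z2, forall t : R, 0 <= t <= 1 -> K (q (f t)).
  by move=> /fiber_path[f fq] Kz1; exists f => t _; rewrite fq.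
apply: unit_interval_ind => [s s01|s t s0 st t1 C1 C2 z z' zs zt]; last first.
  have [zm zmE] : exists zm, q zm = c ((s + t) / 2) by apply: q_lift; apply: Pc; lra.
  by apply: (trans _ zm); [exact: C1|exact: C2].
have [z zs] := q_lift (Pc s s01).
have oqK : open (q @^-1` K) by apply: open_comp => // ? _; exact: q_continuous.
have [|V [oV Vz VK]] := M_lpc (x := z) oqK; first by rewrite /= zs; exact: Kc.
pose TV := \bigcup_(t in @torus R N) (act t @^-1` V).
have oTV : open TV.
  apply: bigcup_open => t tt; apply: open_comp => // ? _; exact: act_slice_continuous.
have TVact t y' : torus t -> TV y' -> TV (act t y').
  move=> tt [u tu Vu]; exists (cmul u (cconj t)).
    by apply: torus_mul => //; exact: torus_conj.
  by rewrite /= (act_mul hact) ?actV //; exact: torus_conj.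
have [W oW TVW] := saturated_open oTV TVact.
have Ws : W (c s).
  rewrite -zs; apply/TVW; exists (cone R N); first exact: cone_torus.
  by rewrite /= (act_one hact).
have /nbhs_ballP[e /= e0 eW] : nbhs s (c @^-1` W).
  by apply: (@segm_continuous _ _ (q x) (q y) s); exact: open_nbhs_nbhs.
exists e => // s1 s2 s10 s12 s21 s1e s2e z1 z2 z1E z2E.
have via z' s' : 0 <= s' <= 1 -> `|s - s'| < e -> q z' = c s' ->
    exists y', [/\ V y', q y' = q z' & K (q z')].
  move=> s'01 s'e z'E; have /TVW[t tt Vt] : W (q z') by rewrite z'E; exact: eW.
  by exists (act t z'); rewrite q_act // z'E; split => //; exact: Kc.
have [|y1 [Vy1 y1E Kz1]] := via z1 s1 _ s1e z1E; first lra.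
have [|y2 [Vy2 y2E Kz2]] := via z2 s2 _ s2e z2E; first lra.
apply: (trans _ y1); first exact: fib.
apply: (trans _ z).
  by have [f fK] := VK _ Vy1; exists (pinv f); exact: (pinv_in (K := q @^-1` K)).
apply: (trans _ y2); first exact: VK.
by apply: fib; rewrite ?y2E.
Qed.

End OrbitSpace.

(** * Boxes in the orbit space *)

Section Boxes.
Variables (R : realType) (n : nat).
Implicit Types (u v p : 'rV[R]_n) (l : 'I_n).

Definition box u v : set 'rV[R]_n := [set p | forall l, u 0 l < p 0 l < v 0 l].

Lemma box_open u v : open (box u v).
Proof.
rewrite openE => p up; rewrite /interior.
have near_l l : nbhs p [set p' : 'rV[R]_n | u 0 l < p' 0 l < v 0 l].
  have /andP[ul vl] := up l.
  near=> p'; apply/andP; split; near: p'.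
  - exact: (cvgr_gt _ (@coord_continuous _ _ _ 0 l p)).
  - exact: (cvgr_lt _ (@coord_continuous _ _ _ 0 l p)).
exact: (filter_forall _ near_l).
Unshelve. all: by end_near. Qed.

Lemma segmE p p' (s : R) l : segm p p' s 0 l = (1 - s) * p 0 l + s * p' 0 l.
Proof. by rewrite !mxE. Qed.

Lemma box_convex u v : convex_in (box u v).
Proof.
move=> p p' s up up' s01 l; rewrite segmE.
have /andP[a b] := up l; have /andP[a' b'] := up' l.
have := convex_lt s01 b b'.
have : (1 - s) * - p 0 l + s * - p' 0 l < - u 0 l by apply: convex_lt => //; lra.
by move=> *; apply/andP; split; lra.
Qed.

Definition set_coord v l (a : R) : 'rV[R]_n :=
  \row_j if j == l then a else v 0 j.

Lemma set_coordE v l a j : set_coord v l a 0 j = if j == l then a else v 0 j.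
Proof. by rewrite mxE. Qed.

End Boxes.

Section SmallBoxes.
Variables (R : realType) (n N : nat) (M : topologicalType).
Variable act : cspace R N -> M -> M.
Hypothesis hact : torus_action act.
Variables (P : set 'rV[R]_n) (q : M -> 'rV[R]_n).
Hypothesis q_continuous : continuous q.
Hypothesis q_range : range q = P.
Hypothesis P_convex : convex_in P.
Hypothesis pconn : forall K, open K -> convex_in K ->
  path_connected_in R (q @^-1` K).

Lemma orbit_generated_sub (K L : set M) :
  K `<=` L -> orbit_generated hact L -> orbit_generated hact K.
Proof. by move=> KL gL x y f g fK gK; apply: gL => t t01; apply/KL; auto. Qed.

(** The two boxes overlap in the slab between [a] and [b], so that
    [orbit_generated_union] applies, unless nothing of M lies over the overlap;
    by convexity all of M over the box then lies over one of its two parts. *)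
Lemma orbit_generated_box_split (u v : 'rV[R]_n) (l : 'I_n) (a b : R) :
  u 0 l < a -> a < b -> b < v 0 l ->
  orbit_generated hact (q @^-1` box u (set_coord v l b)) ->
  orbit_generated hact (q @^-1` box (set_coord u l a) v) ->
  orbit_generated hact (q @^-1` box u v).
Proof.
move=> ua ab bv; set B1 := box u _; set B2 := box _ v => g1 g2.
have B1E p : B1 p <-> box u v p /\ p 0 l < b.
  split=> [h|[h hb] j]; last first.
    by have := h j; rewrite set_coordE; case: eqP => // ->; lra.
  split=> [j|]; last by have := h l; rewrite set_coordE eqxx; lra.
  by have := h j; rewrite set_coordE; case: eqP => // ->; lra.
have B2E p : B2 p <-> box u v p /\ a < p 0 l.
  split=> [h|[h hb] j]; last first.
    by have := h j; rewrite set_coordE; case: eqP => // ->; lra.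
  split=> [j|]; last by have := h l; rewrite set_coordE eqxx; lra.
  by have := h j; rewrite set_coordE; case: eqP => // ->; lra.
have sub : q @^-1` box u v `<=` q @^-1` B1 `|` q @^-1` B2.
  move=> x /= Kx; have [xb|xb] := ltP (q x 0 l) b; first by left; apply/B1E.
  by right; apply/B2E; split => //; lra.
have [ne|nemp] := pselect (q @^-1` B1 `&` q @^-1` B2 !=set0).
  apply: orbit_generated_sub sub _.
  have op w w' : open (q @^-1` box w w').
    by apply: open_comp => [? _|]; [exact: q_continuous|exact: box_open].
  apply: orbit_generated_union => //; try exact: op.
  - by apply: pconn; [exact: box_open|exact: box_convex].
  - by apply: pconn; [exact: box_open|exact: box_convex].
  - rewrite -preimage_setI; apply: pconn.
      by apply: openI; exact: box_open.
    by apply: convex_inI; exact: box_convex.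
have disj : q @^-1` box u v `<=` q @^-1` B1 \/ q @^-1` box u v `<=` q @^-1` B2.
  apply: contrapT => /not_orP[/existsNP[x2 /not_implyP[K2 nB1]]
                               /existsNP[x1 /not_implyP[K1 nB2]]].
  have h1 : q x1 0 l <= a by rewrite leNgt; apply/negP => h; apply: nB2; apply/B2E.
  have h2 : b <= q x2 0 l by rewrite leNgt; apply/negP => h; apply: nB1; apply/B1E.
  (* The point where the segment crosses the middle of the overlap. *)
  pose c := (a + b) / 2; pose s := (c - q x1 0 l) / (q x2 0 l - q x1 0 l).
  have d0 : 0 < q x2 0 l - q x1 0 l by lra.
  have s01 : 0 <= s <= 1.
    apply/andP; split; first by apply: divr_ge0; rewrite /c; lra.
    by rewrite ler_pdivrMr // /c; lra.
  have pl : segm (q x1) (q x2) s 0 l = c.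
    rewrite segmE (_ : _ + _ = q x1 0 l + s * (q x2 0 l - q x1 0 l)); last by ring.
    by rewrite /s mulfVK ?gt_eqF // addrC subrK.
  have box_p : box u v (segm (q x1) (q x2) s) by exact: box_convex.
  have [y yE] : exists y, q y = segm (q x1) (q x2) s.
    apply: (q_lift q_range); apply: P_convex => //; exact: q_in q_range _.
  apply: nemp; exists y; split; rewrite /= yE; [apply/B1E|apply/B2E];
    by split=> //; rewrite pl /c; lra.
by case: disj => h; apply: orbit_generated_sub h _.
Qed.

(** A side of length w is covered by its first and last two thirds. The exponents
    e_l count how many such cuts coordinate l still needs, and the induction is on
    their sum. *)
Lemma orbit_generated_boxes (delta : R) : 0 < delta ->
  (forall u v : 'rV[R]_n, (forall l, v 0 l - u 0 l < delta) ->
    orbit_generated hact (q @^-1` box u v)) ->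
  forall u v : 'rV[R]_n, orbit_generated hact (q @^-1` box u v).
Proof.
move=> d0 small.
have main (k : nat) (e : 'I_n -> nat) (u v : 'rV[R]_n) : (\sum_l e l <= k)%N ->
    (forall l, v 0 l - u 0 l < delta * (3 / 2) ^+ e l) ->
    orbit_generated hact (q @^-1` box u v).
  elim: k e u v => [|k IHk] e u v.
    rewrite leqn0 sum_nat_eq0 => /forallP /= e0 uv; apply: small => l.
    by have := uv l; rewrite (eqP (e0 l)) mulr1.
  move=> ek uv; have [l el|el] := pickP (fun l => 0 < e l)%N; last first.
    apply: small => l; have := uv l; have := el l.
    by rewrite lt0n => /negbFE/eqP ->; rewrite mulr1.
  have [w0|w0] := leP (v 0 l - u 0 l) 0.
    move=> x y f g fV; have := fV 0; rewrite lexx ler01 => /(_ isT)/(_ l); lra.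
  pose e' j := if j == l then (e l).-1 else e j.
  have ek' : (\sum_j e' j <= k)%N.
    rewrite -ltnS; apply: leq_trans ek.
    rewrite (bigD1 l) //= [ltnRHS](bigD1 l) //= {1}/e' eqxx -addSn prednK //.
    by rewrite leq_add2l; apply: leq_sum => j /negbTE jl; rewrite /e' jl.
  have el' : delta * (3 / 2) ^+ e l = delta * (3 / 2) ^+ e' l * (3 / 2).
    rewrite /e' eqxx; case: (e l) el => //= j _.
    by rewrite exprSr -[RHS]mulrA.
  have step a b : b - a = (v 0 l - u 0 l) * 2 / 3 -> b - a < delta * (3 / 2) ^+ e' l.
    by have := uv l; rewrite el' => ? ?; lra.
  apply: (@orbit_generated_box_split u v l (u 0 l + (v 0 l - u 0 l) / 3)
    (u 0 l + (v 0 l - u 0 l) * 2 / 3)); try lra.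
  - apply: (IHk e') => // j; rewrite set_coordE; case: eqP => [->|/eqP jl].
      by apply: step; lra.
    by rewrite /e' (negbTE jl).
  - apply: (IHk e') => // j; rewrite set_coordE; case: eqP => [->|/eqP jl].
      by apply: step; lra.
    by rewrite /e' (negbTE jl).
move=> u v.
have grow (k : nat) : 1 + k%:R / 2 <= (3 / 2) ^+ k :> R.
  elim: k => [|k IHk]; first by rewrite mul0r addr0.
  rewrite exprS -natr1; have := ler0n R k; nra.
have big l : exists k : nat, v 0 l - u 0 l < delta * (3 / 2) ^+ k.
  exists (Num.truncn (2 * (v 0 l - u 0 l) / delta)).+1.
  have := truncnS_gt (2 * (v 0 l - u 0 l) / delta).
  rewrite ltr_pdivrMr //; have := grow (Num.truncn (2 * (v 0 l - u 0 l) / delta)).+1.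
  by set y := _ ^+ _; set z := _%:R; nra.
have [e eE] := choice big.
exact: (main (\sum_l e l)%N e).
Qed.

End SmallBoxes.

(** * The polytope, and the theorem *)

Section PolytopeSet.
Variables (R : realType) (n m : nat) (a : 'I_m -> 'rV[R]_n) (b : 'I_m -> R).

Lemma dotp_continuous (u : 'rV[R]_n) : continuous (dotp u).
Proof.
rewrite /dotp; elim: (index_enum _) => [|j r IH].
  rewrite (_ : (fun _ => _) = fun=> 0); first by cts.
  by apply/funext => v; rewrite big_nil.
rewrite (_ : (fun _ => _) =
  fun v : 'rV[R]_n => u 0 j * v 0 j + \sum_(i <- r) u 0 i * v 0 i).
  have cj := @coord_continuous R 1 n 0 j.
  by apply: continuous_addf; [apply: continuous_mulf; [cts|exact: cj]|exact: IH].
by apply/funext => v; rewrite big_cons.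
Qed.

Lemma dotp_segm (u p p' : 'rV[R]_n) (s : R) :
  dotp u (segm p p' s) = (1 - s) * dotp u p + s * dotp u p'.
Proof.
rewrite /dotp !mulr_sumr -big_split; apply: eq_bigr => j _.
by rewrite segmE /=; ring.
Qed.

Lemma polytope_convex : convex_in (polytope a b).
Proof.
move=> p p' s ap ap' s01 i; rewrite dotp_segm.
by have := ap i; have := ap' i; nra.
Qed.

Lemma polytope_closed : closed (polytope a b).
Proof.
rewrite (_ : polytope a b =
  \bigcap_(i in [set: 'I_m]) (dotp (a i) @^-1` [set x | x <= b i])).
  apply: closed_bigI => i _; apply: preimage_closed; last exact: closed_le.
  by move=> p _; exact: dotp_continuous.
by apply/seteqP; split=> p ap i; [move=> _|]; exact: ap.
Qed.

End PolytopeSet.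

Theorem lemma2p5 (R : realType) (n k m : nat) (M : topologicalType)
    (A : set (chart R M (2 * n + k)))
    (act : cspace R (n + k) -> M -> M)
    (a : 'I_m -> 'rV[R]_n) (b : 'I_m -> R) (q : M -> 'rV[R]_n)
    (lam : 'I_m -> 'rV[int]_(n + k)) :
  locally_k_standard_T_manifold A act ->
  simple_polytope a b ->
  orbit_map act a b q ->
  preserves_corners A act a b q ->
  hyper_characteristic act a b q lam ->
  rk lam = (n + k)%N ->
  forall x0 : M, finite_abelian_group (pi1 R x0) (pi1_mul x0) (pi1_one R x0).
Proof.
move=> [[_ _ [Ac Acov _]] [act1 actM actC _] _ std] [Pb _ Pfacet _].
move=> [cq rq fq qq] _ hyp rklam x0.
have hact : torus_action act by split.
have lpc := chart_locally_path_connected Ac Acov.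
have cvx := polytope_convex (a := a) (b := b).
have pconn := preimage_path_connected hact cq rq fq qq lpc cvx.
have Pc : compact (polytope a b).
  by apply: bounded_closed_compact => //; exact: polytope_closed.
(* A Lebesgue number for the cover of the polytope by images of charts. *)
have [delta d0 small] : exists2 e : R, 0 < e & forall p, polytope a b p ->
    orbit_generated hact (q @^-1` ball p e).
  apply: (lebesgue_number (Q := fun B => orbit_generated hact (q @^-1` B)) Pc).
    by move=> B B' BB'; apply: orbit_generated_sub => x /=; exact: BB'.
  move=> p /(q_lift rq)[x xp]; have [s hs sx] := std x.
  have [V [oV Vx Vact gV]] := std_chart_nbhs hact hs sx.
  have [W oW VW] := saturated_open rq fq qq oV Vact.
  have /nbhs_ballP[e /= e0 eW] : nbhs p W.
    by apply: open_nbhs_nbhs; split => //; rewrite -xp; exact/VW.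
  by exists e => //; apply: orbit_generated_sub gV => y /eW /VW.
have gbox u v : orbit_generated hact (q @^-1` box u v).
  apply: (orbit_generated_boxes cq rq cvx pconn d0) => {}u {}v uv x y f g fK gK.
  (* A small box containing q x lies in the ball around q x. *)
  have ux : box u v (q x) by rewrite -(path0 f); apply: fK; lra.
  apply: (small (q x) (q_in rq x)) => // t t01.
    split => // i j; rewrite (ord1 i).
    have := fK t t01 j; have := ux j; have := uv j; rewrite /ball /= ltr_norml.
    by move=> ? /andP[? ?] /andP[? ?]; apply/andP; split; lra.
  split => // i j; rewrite (ord1 i).
  have := gK t t01 j; have := ux j; have := uv j; rewrite /ball /= ltr_norml.
  by move=> ? /andP[? ?] /andP[? ?]; apply/andP; split; lra.
have gM : orbit_generated hact [set: M].
  have [B [_ BP]] := Pb.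
  apply: orbit_generated_sub (gbox (const_mx (- (B + 2))) (const_mx (B + 2))).
  move=> x _ l; rewrite !mxE.
  have /BP/(_ _ (q_in rq x)) qB : B < B + 1 by rewrite ltrDl.
  have : `|q x 0 l| <= B + 1.
    apply: le_trans qB; rewrite [leRHS]/Num.norm /= mx_normrE.
    by apply: (le_bigmax _ (fun i : 'I_1 * 'I_n => `|q x i.1 i.2|) (0, l)).
  by rewrite ler_norml => /andP[? ?]; apply/andP; split; lra.
have gen x (f : path R x x) : exists v, f ≈ orbit_loop hact v x.
  have [v fv] := gM x x f (pcst R x) (fun _ _ => I) (fun _ _ => I).
  by exists v; rewrite fv pcatp1.
apply: (@finite_abelian_of_orbit_loops _ _ _ _ _ hact _ lam (gen x0) _ rklam) => i.
have [p pi] := Pfacet i.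
have ip : facet a b i p.
  by have : i \in facets_at a b p by [rewrite pi inE]; rewrite inE => /asboolP.
have [y yp] := q_lift rq ip.1.
(* The circle of lam i fixes the points above facet i. *)
have triv : orbit_loop hact (lam i) y ≈ pcst R y.
  apply: orbit_loop_const => t; have [_ lamE] := hyp i.
  have := expT_circle_of (lam i) t; rewrite -lamE => -[_]; apply.
  by rewrite yp.
have [f _] := pconn setT openT (fun _ _ _ _ _ _ => I) x0 y I I.
rewrite -[orbit_loop _ _ _]pcatp1 -(pcatV f) pcatA.
by rewrite orbit_loop_natural triv pcatp1.
Qed.
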